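(* Let $X$ be any element in the orbit B7 in $\mathcal H(2)$. Then for any irrational number $\alpha=[a_1,a_2,\dots]\in(0,1)$ we have $$L(X,\alpha)=7\cdot\limsup_{n\to\infty}\ \max_{1\le i\le a_n}\ \frac{D(n,i,\alpha)}{m^2\big(R\cdot g(a_1,\dots,a_{n-1},i)\cdot X\big)}.$$
   Context: Continued fractions: $[a_1,a_2,\dots]:=\cfrac{1}{a_1+\cfrac{1}{a_2+\cdots}}$, and similarly for finite expansions. For $\alpha=[a_1,a_2,\dots]$, $n\ge1$ and $1\le i\le a_n$ define $$D(n,a_n,\alpha):=[a_n,a_{n-1},\dots,a_1]+a_{n+1}+[a_{n+2},a_{n+3},\dots],$$ $$D(n,i,\alpha):=[i,a_{n-1},\dots,a_1]+[a_n-i,a_{n+1},a_{n+2},\dots]\quad\text{if }1\le i<a_n.$$ Let $T=\begin{pmatrix}1&1\\0&1\end{pmatrix}$, $R=\begin{pmatrix}0&-1\\1&0\end{pmatrix}$, and $$g(a_1,\dots,a_n):=(T^{\epsilon_na_n}R)\cdots(T^{-a_2}R)(T^{a_1}R),\qquad \epsilon_k=+1\text{ for }k\text{ odd},\ \epsilon_k=-1\text{ for }k\text{ even}.$$ Translation surfaces: $S=(M,w)$ is a compact Riemann surface with a nonzero holomorphic 1-form; $\mathcal H(2)$ is the stratum of those of genus 2 where $w$ has a single zero, of order 2. $\mathrm{SL}(2,\mathbb R)$ acts by post-composition with $w$. $\mathrm{Hol}(S)$ is the set of periods $\int_\gamma w$ of saddle connections; $\mathrm{Sys}(S):=\min_{v\in\mathrm{Hol}(S)}|v|$.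 With $g_t=\mathrm{diag}(e^t,e^{-t})$ and $r_\theta=\begin{pmatrix}\cos\theta&-\sin\theta\\ \sin\theta&\cos\theta\end{pmatrix}$, set $L(S):=\limsup_{t\to+\infty}2/\mathrm{Sys}(g_t\cdot S)^2$ (which equals $\limsup_{|\mathrm{Im}\,v|\to\infty}\frac{1}{|\mathrm{Re}\,v||\mathrm{Im}\,v|}$ over periods $v$ if there is no vertical saddle connection) and $L(S,\alpha):=L(r_{\arctan\alpha}\cdot S)$, where surfaces are normalized to area 1 (an origami with $N$ unit squares is rescaled to area 1 when computing $L$). Origamis: an origami is a translation surface tiled by copies of $[0,1]^2$, i.e. with a covering $\rho:S\to\mathbb R^2/\mathbb Z^2$ unramified outside $0$ with 1-form $\rho^*(dz)$; it is primitive if its periods generate $\mathbb Z^2$. Orbit B7, denoted $\mathcal O$: the set of primitive origamis in $\mathcal H(2)$ with 7 squares having exactly three integer Weierstrass points, i.e. exactly three of the six fixed points of the hyperelliptic involution lie in $\rho^{-1}(0)$ (the zero of $w$ is counted); it is a single $\mathrm{SL}(2,\mathbb Z)$-orbit with 36 elements. For $Y\in\mathcal O$, $m(Y)$ is the horizontal multiplicity: the minimal length (a positive integer, in units of the side of a square) of a horizontal saddle connection of $Y$; it takes values in $\{1,2\}$. *)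

(* Defs.v *)
From HB Require Import structures.
From mathcomp Require Import all_boot all_order all_algebra all_fingroup.
From mathcomp Require Import all_classical all_reals all_analysis.

Set Implicit Arguments.
Unset Strict Implicit.
Unset Printing Implicit Defensive.

Import Order.TTheory GRing.Theory Num.Theory.
Import numFieldNormedType.Exports.

Local Open Scope classical_set_scope.
Local Open Scope ring_scope.

Definition vec2 (R : realType) (x y : R) : 'cV[R]_2 :=
  \col_(i < 2) (if i == 0 then x else y).

Definition mx2 (R : realType) (a b c d : R) : 'M[R]_2 :=
  \matrix_(i < 2, j < 2)
    (if i == 0 then if j == 0 then a else b else if j == 0 then c else d).

Definition xco (R : realType) (u : 'cV[R]_2) : R := u 0 0.
Definition yco (R : realType) (u : 'cV[R]_2) : R := u 1 0.

(* The Euclidean norm: the library norm on matrices is the sup norm. *)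
Definition enorm (R : realType) (u : 'cV[R]_2) : R :=
  Num.sqrt (xco u ^+ 2 + yco u ^+ 2).

(* The surface obtained from N closed squares [0,1]^2, labelled by 'I_N, by
   gluing the right side of square i to the left side of square [hperm i] and
   the top side of i to the bottom side of [vperm i], where w is the 1-form
   whose restriction to each square is the pull-back of dz by the linear map
   z |-> frame *m z; in the flat metric it is tiled by N translates of the
   parallelogram frame [0,1]^2.  The frame 1 gives the origamis.  Only frames
   of positive determinant are meaningful (and only those are used below). *)
Record tsurf (R : realType) (N : nat) := TSurf {
  hperm : 'S_N;
  vperm : 'S_N;
  frame : 'M[R]_2 }.

(* Post-composition of w with g. *)
Definition surf_act (R : realType) (N : nat) (g : 'M[R]_2) (S : tsurf R N) :
  tsurf R N := TSurf (hperm S) (vperm S) (g *m frame S).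

Definition point (R : realType) (N : nat) : Type := ('I_N * 'cV[R]_2)%type.

Definition in_square (R : realType) (N : nat) (p : point R N) : Prop :=
  (0 <= xco p.2 <= 1) && (0 <= yco p.2 <= 1).

Inductive glued (R : realType) (N : nat) (S : tsurf R N) :
  point R N -> point R N -> Prop :=
| glued_h i y of 0 <= y <= 1 :
    glued S (i, vec2 1 y) (hperm S i, vec2 0 y)
| glued_v i x of 0 <= x <= 1 :
    glued S (i, vec2 x 1) (vperm S i, vec2 x 0)
| glued_refl p : glued S p p
| glued_sym p q of glued S p q : glued S q p
| glued_trans p q r of glued S p q & glued S q r : glued S p r.

(* The point of the surface represented by p. *)
Definition cls (R : realType) (N : nat) (S : tsurf R N) (p : point R N) :
  set (point R N) := [set q | glued S p q].

(* The preimage of 0 under the covering rho : S -> R^2 / Z^2 (for frame 1). *)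
Definition integer_point (R : realType) (N : nat) (p : point R N) : Prop :=
  ((xco p.2 == 0) || (xco p.2 == 1)) && ((yco p.2 == 0) || (yco p.2 == 1)).

Definition vertices (R : realType) (N : nat) (S : tsurf R N) :
  set (set (point R N)) := cls S @` [set p | integer_point p].

Definition corner (R : realType) (N : nat) (c : 'I_N * (bool * bool)) :
  point R N := (c.1, vec2 (c.2.1)%:R (c.2.2)%:R).

Definition ncorners (R : realType) (N : nat) (S : tsurf R N)
  (p : point R N) : nat :=
  #|[pred c : 'I_N * (bool * bool) | `[< glued S p (corner R c) >]]|.

(* The order of vanishing of w at p: at an integer point of an origami,
   [ncorners p] angles pi/2 meet, and a zero of order k is a point of cone
   angle 2 pi (k + 1).  The other points have [ncorners] 0, hence order 0. *)
Definition w_order (R : realType) (N : nat) (S : tsurf R N)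
  (p : point R N) : nat := (ncorners S p %/ 4).-1.

Definition is_zero (R : realType) (N : nat) (S : tsurf R N)
  (p : point R N) : Prop := (0 < w_order S p)%N.

Definition connected_tsurf (R : realType) (N : nat) (S : tsurf R N) : Prop :=
  [transitive <<[set hperm S; vperm S]%SET>>%g, on [set: 'I_N]%SET | 'P].

(* Euler's formula for the tiling, which has 2N edges and N faces. *)
Definition has_genus (R : realType) (N : nat) (S : tsurf R N) (g : nat) :
  Prop :=
  exists V : nat, (vertices S #= `I_V)%card /\
    V%:Z - (2 * N)%:Z + N%:Z = 2 - 2 * g%:Z.

Definition in_H2 (R : realType) (N : nat) (S : tsurf R N) : Prop :=
  has_genus S 2 /\
  exists2 p : point R N, in_square p & w_order S p = 2%N /\
    forall q, in_square q -> is_zero S q -> glued S p q.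

(* [straight S u p q l]: a straight segment of S from p to q whose integral
   of w is l *: u with l > 0, and with no zero of w in its interior.  A
   segment is cut into pieces that each lie in one closed square; the interior
   of a piece contains no corner of the square, hence no zero, so that only
   the points where two pieces meet have to be tested. *)
Inductive straight (R : realType) (N : nat) (S : tsurf R N) (u : 'cV[R]_2) :
  point R N -> point R N -> R -> Prop :=
| straight_piece i z z' l of
    in_square (i, z) & in_square (i, z') & 0 < l
    & frame S *m (z' - z) = l *: u :
    straight S u (i, z) (i, z') l
| straight_cat p q q' r l m of
    straight S u p q l & glued S q q' & ~ is_zero S q
    & straight S u q' r m :
    straight S u p r (l + m).

Definition Hol (R : realType) (N : nat) (S : tsurf R N) : set 'cV[R]_2 :=
  [set u | u <> 0 /\ exists p q : point R N,
     [/\ is_zero S p, is_zero S q & straight S u p q 1]].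

(* Hol S is closed and discrete: this infimum, and the one in [hmult], is a
   minimum. *)
Definition Sys (R : realType) (N : nat) (S : tsurf R N) : R :=
  inf (@enorm R @` Hol S).

Definition hmult (R : realType) (N : nat) (S : tsurf R N) : R :=
  inf (@enorm R @` [set u | Hol S u /\ yco u = 0]).

Definition area (R : realType) (N : nat) (S : tsurf R N) : R :=
  N%:R * \det (frame S).

Definition normalize (R : realType) (N : nat) (S : tsurf R N) : tsurf R N :=
  surf_act ((Num.sqrt (area S))^-1)%:M S.

Definition geod (R : realType) (t : R) : 'M[R]_2 :=
  mx2 (expR t) 0 0 (expR (- t)).

Definition rot (R : realType) (theta : R) : 'M[R]_2 :=
  mx2 (cos theta) (- sin theta) (sin theta) (cos theta).

Definition L (R : realType) (N : nat) (S : tsurf R N) : \bar R :=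
  limf_esup
    (fun t : R => (2 / Sys (surf_act (geod t) (normalize S)) ^+ 2)%:E)
    (pinfty_nbhs R).

Definition Ldir (R : realType) (N : nat) (S : tsurf R N) (alpha : R) :
  \bar R := L (surf_act (rot (atan alpha)) S).

Definition is_origami (R : realType) (N : nat) (S : tsurf R N) : Prop :=
  frame S = 1%:M /\ connected_tsurf S.

Definition generated_subgroup (R : realType) (A : set 'cV[R]_2) :
  set 'cV[R]_2 :=
  [set u | forall G : set 'cV[R]_2, G 0 ->
     (forall v w, G v -> G w -> G (v - w)) -> A `<=` G -> G u].

Definition primitive (R : realType) (N : nat) (S : tsurf R N) : Prop :=
  generated_subgroup (Hol S) =
  [set u | exists a b : int, u = vec2 (a%:~R) (b%:~R)].

(* The map sending each square i to the square [s i] by a rotation by pi. *)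
Definition half_turn (R : realType) (N : nat) (s : 'S_N) (p : point R N) :
  point R N := (s p.1, vec2 1 1 - p.2).

Definition fixed_points (R : realType) (N : nat) (S : tsurf R N) (s : 'S_N) :
  set (point R N) :=
  [set p | in_square p /\ glued S p (half_turn s p)].

(* [half_turn s] is the hyperelliptic involution of the origami S of genus 2:
   it is well defined on S, an involution, and has six fixed points.  The
   hyperelliptic involution J of a surface in H(2) satisfies J^*w = -w and
   fixes the zero of w, so rho \o J = - rho: it permutes the squares, acting
   on each of them by a rotation by pi. *)
Definition hyperelliptic (R : realType) (N : nat) (S : tsurf R N) (s : 'S_N) :
  Prop :=
  [/\ forall i, s (hperm S i) = ((hperm S)^-1)%g (s i),
      forall i, s (vperm S i) = ((vperm S)^-1)%g (s i),
      forall i, s (s i) = i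
    & (cls S @` fixed_points S s #= `I_6)%card].

Definition B7 (R : realType) (S : tsurf R 7) : Prop :=
  [/\ is_origami S, in_H2 S, primitive S
    & exists2 s : 'S_7, hyperelliptic S s &
        (cls S @` [set p | fixed_points S s p /\ integer_point p]
           #= `I_3)%card].

(* [a_1, ..., a_n], with the value 0 for the empty sequence. *)
Definition cf (R : realType) (s : seq nat) : R :=
  foldr (fun a x => (a%:R + x)^-1) 0 s.

(* [b 0, b 1, b 2, ...]. *)
Definition cf_inf (R : realType) (b : nat -> nat) : R :=
  limn (fun n => cf R (mkseq b n)).

(* D(n, i, alpha) for alpha = [a 1, a 2, ...]; the value a 0 is irrelevant for n > 0. *)
Definition D (R : realType) (a : nat -> nat) (n i : nat) : R :=
  if i == a n then
    cf R [seq a j | j <- rev (iota 1 n)] + (a n.+1)%:R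
      + cf_inf R (fun k => a (n + 2 + k)%N)
  else
    cf R (i :: [seq a j | j <- rev (iota 1 n.-1)])
      + cf_inf R (fun k => if k is 0%N then (a n - i)%N else a (n + k)%N).

Definition Tmx (R : realType) : 'M[R]_2 := mx2 1 1 0 1.
Definition Rmx (R : realType) : 'M[R]_2 := mx2 0 (- 1) 1 0.

Definition eps (k : nat) : int := if odd k then 1 else - 1.

(* g(a_1, ..., a_n); the factor of index n is the leftmost one. *)
Definition gmx (R : realType) (s : seq nat) : 'M[R]_2 :=
  \prod_(k <- rev (iota 1 (size s)))
     (Tmx R ^ (eps k * (nth 0%N s k.-1)%:Z) * Rmx R).

(* Main.v *)
(** The periods of X are integer vectors, and the period of smallest length in a
    rational direction is m v, where v is the primitive vector of that direction.
    Balancing the two coordinates by the geodesic flow (AM-GM) turns L(X, alpha)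
    into 7 times the limsup of 1 / (m^2 q |q alpha - p|) over all primitive (p, q),
    and for the intermediate convergents 1 / (q |q alpha - p|) is exactly D(n, i).
    Every other (p, q) has q |q alpha - p| >= 1, so it only remains to see that the
    right-hand side is at least 7.  This uses two facts about multiplicities in a
    surface with seven squares, three of which have the zero as lower-left corner:
    m is at most 2, and for any basis (v, w) of Z^2 one of v, w, v + w has m = 1.
    Shears reduce both to the standard basis, where they are pigeonhole arguments:
    if Z is the set of those three squares, h and v the gluing permutations, then
    neither Z, h Z, h^2 Z nor Z, h Z, h v Z can be pairwise disjoint. *)

(* The danger lies in the division by m^2: a convergent of multiplicity 2 may contribute less than
   1, while a vector that is not an intermediate convergent may contribute up to 1. Hence the
   search, arbitrarily far along the expansion, for a direction of multiplicity 1 whose value is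
   large enough. The number three reflects the cone angle 6 pi of a double zero: it is the length of
   a cycle of the commutator [[~ v, h]], and 7 < 3 * 3 is what feeds the pigeonhole. A matrix acting
   on X only changes its frame, so the multiplicity of R g X is read off the periods of X itself.
   Retiling occurs only when a basis is reduced to the standard one, by the shear (h, v) -> (h, h *
   v) and the exchange of h and v, both of which keep the set of singular squares. Because the
   direction is reached by a rotation, the product of the coordinates of (p, q) equals q |q alpha -
   p| only up to a relative error that vanishes as q grows. Both inequalities are therefore proved
   with a margin (B < B', b < b2), which is removed at the end. *)
Require Import Defs.
From HB Require Import structures.
From mathcomp Require Import all_boot all_order all_algebra all_fingroup.
From mathcomp Require Import all_classical all_reals all_analysis.
From mathcomp Require Import zify ring lra.

Set Implicit Arguments.
Unset Strict Implicit.
Unset Printing Implicit Defensive.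

Import Order.TTheory GRing.Theory Num.Theory.
Import numFieldNormedType.Exports.

Local Open Scope classical_set_scope.
Local Open Scope ring_scope.

(** * Corners of the squares and zeros *)

(* The square that has the vertex [c] as lower-left corner; [~ v, h] turns once
   around that corner. *)
Definition corner_rep (N : nat) (h v : 'S_N) (c : 'I_N * (bool * bool)) : 'I_N :=
  let i := if c.2.1 then h c.1 else c.1 in if c.2.2 then v i else i.

(* The lower-left corner of square [i] is a zero. *)
Definition singular (N : nat) (h v : 'S_N) (i : 'I_N) : bool :=
  [~ v, h]%g i != i.

(** Going from [i] right then up, or up then right, leads to two squares whose lower-left corner is
    the upper-right corner of [i]; they are one turn apart around it. Permutations compose from left
    to right. *)
Lemma commE (N : nat) (h v : 'S_N) i : [~ v, h]%g (v (h i)) = h (v i).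
Proof. by rewrite -!permM mulgA -[(h * v * _)%g]commgC permM. Qed.

Lemma vec2_inj (R : realType) (x y x' y' : R) :
  vec2 x y = vec2 x' y' -> x = x' /\ y = y'.
Proof.
by move=> /matrixP e; have := e 0 0; have := e 1 0; rewrite !mxE.
Qed.

Lemma corner_inj (R : realType) (N : nat) : injective (@corner R N).
Proof.
move=> [i [a b]] [j [c d]] [-> /vec2_inj[/= /eqP + /eqP]]; rewrite !eqr_nat.
by case: a; case: c => // _; case: b; case: d.
Qed.

(** Induction on the gluing; the two-sided form lets symmetry and transitivity go through. A
    horizontal gluing keeps the representative, and a vertical one changes it only at the right end
    of the edge, by one commutator. *)
Lemma glued_corner_rep (R : realType) (N : nat) (S : tsurf R N) p q :
  glued S p q ->
  (forall c, p = corner R c -> exists2 d, q = corner R d &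
     corner_rep (hperm S) (vperm S) d
       \in porbit [~ vperm S, hperm S]%g (corner_rep (hperm S) (vperm S) c)) /\
  (forall d, q = corner R d -> exists2 c, p = corner R c &
     corner_rep (hperm S) (vperm S) d
       \in porbit [~ vperm S, hperm S]%g (corner_rep (hperm S) (vperm S) c)).
Proof.
elim=> {p q} [i y _|i x _|p|p q _ [IH1 IH2]|p q r _ [pq1 pq2] _ [qr1 qr2]].
- split=> [[j [a b]] [<- /vec2_inj[e ->]]|[j [a b]] [<- /vec2_inj[e ->]]].
    case: a e => [_|/eqP]; last by rewrite oner_eq0.
    by exists (hperm S i, (false, b)) => //=; exact: porbit_id.
  case: a e => [/esym/eqP|_]; first by rewrite oner_eq0.
  by exists (i, (true, b)) => //=; exact: porbit_id.
- split=> [[j [a b]] [<- /vec2_inj[-> e]]|[j [a b]] [<- /vec2_inj[-> e]]].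
    case: b e => [_|/eqP]; last by rewrite oner_eq0.
    exists (vperm S i, (a, false)) => //=; case: a; last exact: porbit_id.
    by rewrite /corner_rep /= -commE; have := mem_porbit [~ vperm S, hperm S]%g 1 _;
      apply.
  case: b e => [/esym/eqP|_]; first by rewrite oner_eq0.
  exists (i, (a, true)) => //=; case: a; last exact: porbit_id.
  by rewrite /corner_rep /= -commE; have := mem_porbit [~ vperm S, hperm S]%g 1 _; apply.
- by split=> c ->; exists c => //; exact: porbit_id.
- split=> c /[dup] + e; [case/IH2|case/IH1] => d -> //.
    by rewrite porbit_sym; exists d.
  by rewrite porbit_sym; exists d.
- split.
    move=> c /pq1[d /qr1[e -> h1] h2]; exists e => //.
    by move: h2; rewrite -!eq_porbit_mem => /eqP <-; rewrite eq_porbit_mem.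
  move=> c /qr2[d /pq2[e -> h1] h2]; exists e => //.
  by move: h1; rewrite -!eq_porbit_mem => /eqP <-; rewrite eq_porbit_mem.
Qed.

Lemma natr_bool_itv (R : realType) (b : bool) : 0 <= (b%:R : R) <= 1.
Proof. by case: b; rewrite ?lexx ler01. Qed.

Lemma glued_rep (R : realType) (N : nat) (S : tsurf R N) c :
  glued S (corner R c) (corner R (corner_rep (hperm S) (vperm S) c, (false, false))).
Proof.
have gh i b : glued S (corner R (i, (true, b))) (corner R (hperm S i, (false, b))).
  exact: glued_h (natr_bool_itv R b).
have gv i b : glued S (corner R (i, (b, true))) (corner R (vperm S i, (b, false))).
  exact: glued_v (natr_bool_itv R b).
case: c => i [[] []]; rewrite /corner_rep /=.
- by apply: glued_trans (gh _ _) _; exact: gv.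
- exact: gh.
- exact: gv.
- exact: glued_refl.
Qed.

Lemma glued_comm (R : realType) (N : nat) (S : tsurf R N) i :
  glued S (corner R (i, (false, false)))
    (corner R ([~ vperm S, hperm S]%g i, (false, false))).
Proof.
set h := hperm S; set v := vperm S.
have -> : i = v (h ((h^-1)%g ((v^-1)%g i))) by rewrite !permKV.
set j := (h^-1)%g _; rewrite commE.
apply: glued_trans; first by apply: glued_sym; exact: (glued_rep S (j, (true, true))).
apply: glued_trans (glued_rep S (v j, (true, false))).
exact: (@glued_v _ _ S j 1 (natr_bool_itv R true)).
Qed.

(** Hence the vertices of the tiling correspond to the cycles of the commutator. *)
Lemma glued_cornerE (R : realType) (N : nat) (S : tsurf R N) c d :
  glued S (corner R c) (corner R d) <->
  corner_rep (hperm S) (vperm S) d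
    \in porbit [~ vperm S, hperm S]%g (corner_rep (hperm S) (vperm S) c).
Proof.
split=> [/glued_corner_rep[/(_ _ erefl)[e /corner_inj <- //] _]|].
case/porbitP=> n e.
apply: glued_trans (glued_rep S c) _.
apply: glued_trans; last by apply: glued_sym; exact: glued_rep.
rewrite e; elim: n {e} => [|n IH]; first by rewrite expg0 perm1; exact: glued_refl.
by rewrite expgSr permM; apply: glued_trans IH _; exact: glued_comm.
Qed.

(** For each of the four positions of a corner, passing to the representative is a bijection of the
    squares, so every square represents exactly four corners. *)
Lemma card_corners (N : nat) (h v : 'S_N) (Q : pred 'I_N) :
  #|[pred c | Q (corner_rep h v c)]| = (4 * #|Q|)%N.
Proof.
pose F c := (corner_rep h v c, c.2).
have F_inj : injective F.
  move=> [i [a b]] [j [c d]] [/[swap] -> /[swap] ->]; rewrite /corner_rep /=.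
  by case: d => [/= /perm_inj|/=]; case: c => [/perm_inj|] ->.
pose G := [pred d : 'I_N * (bool * bool) | Q d.1].
have -> : #|[pred c | Q (corner_rep h v c)]| = #|G|.
  by rewrite -!sum1_card [RHS](reindex_inj F_inj).
have -> : #|G| = #|[predX Q & predT : pred (bool * bool)]|.
  by apply: eq_card => -[i b]; rewrite !inE andbT.
by rewrite cardX cardT -cardE card_prod card_bool mulnC.
Qed.

(** The cone angle at a vertex is thus 2 pi times the length of its cycle, and the order of [w] is
    that length minus 1. *)
Lemma ncorners_corner (R : realType) (N : nat) (S : tsurf R N) c :
  ncorners S (corner R c) =
    (4 * #|porbit [~ vperm S, hperm S]%g (corner_rep (hperm S) (vperm S) c)|)%N.
Proof.
rewrite -(card_corners (hperm S) (vperm S)); apply: eq_card => d.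
by rewrite !inE; apply/asboolP/idP => /glued_cornerE.
Qed.

Lemma card_porbit_gt1 (T : finType) (s : {perm T}) x :
  (1 < #|porbit s x|)%N = (s x != x).
Proof.
apply/card_gt1P/idP => [[y [z [+ + ]]]|sx]; last first.
  by exists (s x), x; split => //; [exact: (mem_porbit s 1) | exact: porbit_id].
case/porbitP=> m -> /porbitP[n ->]; apply: contraNneq => sx.
have fixed k : (s ^+ k)%g x = x.
  by elim: k => [|k IH]; rewrite ?expg0 ?perm1// expgS permM sx.
by rewrite !fixed.
Qed.

Lemma is_zeroE (R : realType) (N : nat) (S : tsurf R N) p :
  is_zero S p <-> exists2 c, p = corner R c &
    singular (hperm S) (vperm S) (corner_rep (hperm S) (vperm S) c).
Proof.
rewrite /is_zero /w_order; split=> [p0|[c -> sc]]; last first.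
  by rewrite ncorners_corner mulKn// -subn1 subn_gt0 card_porbit_gt1.
have /card_gt0P[d] : (0 < ncorners S p)%N by case: (ncorners S p) p0.
rewrite unfold_in /= => pd; have g : glued S p (corner R d) by apply/asboolP; exact: pd.
have [_ /(_ _ erefl)[c e _]] := glued_corner_rep g.
exists c => //; move: p0.
by rewrite e ncorners_corner mulKn// -subn1 subn_gt0 card_porbit_gt1.
Qed.

(** A double zero has a cycle of three squares, and a cycle of length at least 2 contains no fixed
    point of the commutator. *)
Lemma card_singular (R : realType) (N : nat) (S : tsurf R N) :
  in_H2 S -> (2 < #|singular (hperm S) (vperm S)|)%N.
Proof.
case=> _ [p _ [ord2 _]].
have /is_zeroE[c pc sc] : is_zero S p by rewrite /is_zero ord2.
move: ord2; rewrite /w_order pc ncorners_corner mulKn// => ord2.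
set O := porbit _ _ in ord2; have : (2 < #|O|)%N by case: #|O| ord2 => // n /= ->.
move=> /leq_trans; apply.
apply: subset_leq_card; apply/fintype.subsetP => i iO.
move: sc; rewrite /singular -!card_porbit_gt1 unfold_in -card_porbit_gt1.
by move: iO; rewrite -eq_porbit_mem => /eqP <-.
Qed.

(** * Straight segments and changes of frame *)

Lemma vec2E (R : realType) (z : 'cV[R]_2) : z = vec2 (xco z) (yco z).
Proof.
apply/matrixP => i j; rewrite !mxE (ord1 j) /xco /yco.
by case: (unliftP 0 i) => [k ->|-> //]; rewrite (ord1 k) /=; congr (z _ _); exact/val_inj.
Qed.

Lemma xco_vec2 (R : realType) (x y : R) : xco (vec2 x y) = x.
Proof. by rewrite /xco mxE. Qed.

Lemma yco_vec2 (R : realType) (x y : R) : yco (vec2 x y) = y.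
Proof. by rewrite /yco mxE. Qed.

Definition vec2co (R : realType) := (@xco_vec2 R, @yco_vec2 R).

Lemma vec2D (R : realType) (x y x' y' : R) : vec2 x y + vec2 x' y' = vec2 (x + x') (y +
  y').
Proof. by apply/matrixP => i j; rewrite !mxE; case: ifP. Qed.

Lemma vec2N (R : realType) (x y : R) : - vec2 x y = vec2 (- x) (- y).
Proof. by apply/matrixP => i j; rewrite !mxE; case: ifP. Qed.

Lemma vec2Z (R : realType) (a x y : R) : a *: vec2 x y = vec2 (a * x) (a * y).
Proof. by apply/matrixP => i j; rewrite !mxE; case: ifP. Qed.

Lemma vec2_eq0 (R : realType) (x y : R) : (vec2 x y = 0) <-> (x = 0 /\ y = 0).
Proof.
split=> [e|[-> ->]]; last by apply/matrixP => i j; rewrite !mxE; case: ifP.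
by apply: vec2_inj; rewrite e; apply/matrixP => i j; rewrite !mxE; case: ifP.
Qed.

Lemma mx2_vec2 (R : realType) (a b c d x y : R) :
  mx2 a b c d *m vec2 x y = vec2 (a * x + b * y) (c * x + d * y).
Proof.
apply/matrixP => i j; rewrite !mxE !big_ord_recl big_ord0 !mxE /= addr0.
by case: ifP.
Qed.

Lemma mx2M (R : realType) (a b c d a' b' c' d' : R) :
  mx2 a b c d *m mx2 a' b' c' d' =
  mx2 (a * a' + b * c') (a * b' + b * d') (c * a' + d * c') (c * b' + d * d').
Proof.
apply/matrixP => i j; rewrite !mxE !big_ord_recl big_ord0 !mxE /= addr0.
by case: ifP => _; case: ifP.
Qed.

Lemma det_mx2 (R : realType) (a b c d : R) : \det (mx2 a b c d) = a * d - b * c.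
Proof.
rewrite (expand_det_row _ 0) !big_ord_recl big_ord0 addr0 /cofactor !det_mx11 !mxE /=.
by rewrite expr0 expr1 mul1r mulN1r mulrN.
Qed.

Lemma scalar_mx2 (R : realType) (a : R) : a%:M = mx2 a 0 0 a.
Proof.
apply/matrixP => i j; rewrite !mxE.
case: (unliftP 0 i) => [k ->|->]; case: (unliftP 0 j) => [l ->|->] //=;
  by rewrite ?(ord1 k) ?(ord1 l) ?mulr1n ?mulr0n ?eqxx.
Qed.

Lemma is_zero_glued (R : realType) (N : nat) (S : tsurf R N) p q :
  glued S p q -> is_zero S p -> is_zero S q.
Proof.
move=> pq; rewrite /is_zero /w_order; suff -> : ncorners S p = ncorners S q by [].
apply: eq_card => c; rewrite !unfold_in /=; apply/asboolP/asboolP => h.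
  exact: glued_trans (glued_sym pq) h.
exact: glued_trans pq h.
Qed.

Lemma straight_in_square (R : realType) (N : nat) (S : tsurf R N) u p q l :
  straight S u p q l -> [/\ in_square p, in_square q & 0 < l].
Proof.
by elim=> // {}p {}q q' r {}l m _ [? ? ?] _ _ _ [? ? ?]; split=> //; exact: addr_gt0.
Qed.

(** Endpoints are taken up to gluing, because a change of tiling may send them to other
    representatives of the same points. *)
Definition straight_mod (R : realType) (N : nat) (S : tsurf R N) u p q l : Prop :=
  exists p' q', [/\ glued S p p', glued S q q' & straight S u p' q' l].

Lemma straight_mod_cat (R : realType) (N : nat) (S : tsurf R N) u p q q' r l m :
  straight_mod S u p q l -> glued S q q' -> ~ is_zero S q ->
  straight_mod S u q' r m -> straight_mod S u p r (l + m).
Proof.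
move=> [p1 [q1 [pp1 qq1 pq]]] qq' zq [q2 [r2 [q'q2 rr2 qr]]].
exists p1, r2; split=> //; apply: straight_cat pq _ _ qr.
  exact: glued_trans (glued_sym qq1) (glued_trans qq' q'q2).
by move=> zq1; apply: zq; exact: is_zero_glued (glued_sym qq1) zq1.
Qed.

Lemma Hol_mod (R : realType) (N : nat) (S : tsurf R N) u p q :
  u <> 0 -> is_zero S p -> is_zero S q -> straight_mod S u p q 1 -> Hol S u.
Proof.
move=> u0 zp zq [p' [q' [pp' qq' pq]]]; split=> //; exists p', q'.
by split=> //; [exact: is_zero_glued pp' zp|exact: is_zero_glued qq' zq].
Qed.

(** Common tool for the linear action, the exchange of axes and the shear: once [phi] respects
    gluing and creates no zeros, only pieces inside one square need a geometric argument. *)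
Lemma straight_map (R : realType) (N : nat) (S S' : tsurf R N)
    (phi : Defs.point R N -> Defs.point R N) u u' p q l :
  (forall p q, glued S p q -> glued S' (phi p) (phi q)) ->
  (forall q, in_square q -> is_zero S' (phi q) -> is_zero S q) ->
  (forall i z z' l, in_square (i, z) -> in_square (i, z') -> 0 < l ->
     frame S *m (z' - z) = l *: u ->
     straight_mod S' u' (phi (i, z)) (phi (i, z')) l) ->
  straight S u p q l -> straight_mod S' u' (phi p) (phi q) l.
Proof.
move=> phi_glued phi_zero phi_piece; elim=> {p q l} [i z z' l|]; first exact: phi_piece.
move=> p q q' r l m pq pq' qq' zq _ qr'.
apply: straight_mod_cat pq' (phi_glued _ _ qq') _ qr' => /phi_zero zq'.
by have [_ /zq' /zq] := straight_in_square pq.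
Qed.

Lemma straight_rev (R : realType) (N : nat) (S : tsurf R N) u p q l :
  straight S u p q l -> straight S (- u) q p l.
Proof.
elim=> {p q l} [i z z' l zs zs' l0 e|p q q' r l m _ qp qq' zq _ rq'].
  by apply: straight_piece => //; rewrite scalerN -e -mulmxN opprB.
rewrite addrC; apply: straight_cat rq' (glued_sym qq') _ qp.
by move=> zq'; apply: zq; exact: is_zero_glued (glued_sym qq') zq'.
Qed.

Lemma Hol_opp (R : realType) (N : nat) (S : tsurf R N) u : Hol S u -> Hol S (- u).
Proof.
case=> u0 [p [q [zp zq pq]]]; split; first by move=> /eqP; rewrite oppr_eq0 => /eqP.
by exists q, p; split=> //; exact: straight_rev.
Qed.

Lemma glued_frame (R : realType) (N : nat) (h v : 'S_N) (f f' : 'M[R]_2) p q :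
  glued (TSurf h v f) p q -> glued (TSurf h v f') p q.
Proof.
elim=> {p q} [i y hy|i x hx|p|p q _|p q r _ h1 _ h2].
- exact: (glued_h (TSurf h v f')).
- exact: (glued_v (TSurf h v f')).
- exact: glued_refl.
- exact: glued_sym.
- exact: glued_trans h1 h2.
Qed.

Lemma is_zero_frame (R : realType) (N : nat) (h v : 'S_N) (f f' : 'M[R]_2) p :
  is_zero (TSurf h v f) p -> is_zero (TSurf h v f') p.
Proof. by move=> /is_zeroE ?; apply/is_zeroE. Qed.

Lemma Hol_act (R : realType) (N : nat) (S : tsurf R N) (M : 'M[R]_2) u :
  M *m u <> 0 -> Hol S u -> Hol (surf_act M S) (M *m u).
Proof.
case: S => h v f Mu0 [u0 [p [q [zp zq pq]]]].
apply: (Hol_mod Mu0 (is_zero_frame _ zp) (is_zero_frame _ zq)).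
apply: (straight_map (S := TSurf h v f) (phi := id)) pq => [p' q'|q' _|].
- exact: glued_frame.
- exact: is_zero_frame.
move=> i z z' l zs zs' l0 e; exists (i, z), (i, z'); split; [exact: glued_refl..|].
by apply: straight_piece; rewrite //= -mulmxA e scalemxAr.
Qed.

Lemma Hol_actE (R : realType) (N : nat) (S : tsurf R N) (M : 'M[R]_2) :
  M \in unitmx -> Hol (surf_act M S) = [set M *m u | u in Hol S].
Proof.
move=> Mu; apply/seteqP; split=> [u uS|_ [u uS <-]]; last first.
  apply: Hol_act => // Mu0; case: uS => u0 _; apply: u0.
  by rewrite -(mulKmx Mu u) Mu0 mulmx0.
exists (invmx M *m u); last by rewrite mulKVmx.
have -> : S = surf_act (invmx M) (surf_act M S).
  by case: S {uS} => h v f; rewrite /surf_act /= mulKmx.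
apply: (Hol_act _ uS) => Mu0; case: (uS) => u0 _; apply: u0.
by rewrite -(mulKVmx Mu u) Mu0 mulmx0.
Qed.

(** * Exchange of the axes and horizontal shear *)

Lemma singularC (N : nat) (h v : 'S_N) i : singular v h i = singular h v i.
Proof.
rewrite /singular -[in LHS]invgR -(inj_eq (@perm_inj _ [~ v, h]%g)) permKV.
by rewrite eq_sym.
Qed.

Lemma singular_hv (N : nat) (h v : 'S_N) i : singular h v (h (v i)) = singular h v (v (h
  i)).
Proof. by rewrite -commE /singular (inj_eq perm_inj). Qed.

Lemma swap_zero (R : realType) (N : nat) (h v : 'S_N) i (x y : R) :
  is_zero (TSurf h v 1%:M) (i, vec2 x y) -> is_zero (TSurf v h 1%:M) (i, vec2 y x).
Proof.
move=> /is_zeroE[[j [a b]] [<- /vec2_inj[-> ->]] /= sc]; apply/is_zeroE.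
exists (i, (b, a)) => //=; rewrite singularC.
by case: a b sc => [] [] //=; rewrite /corner_rep /= singular_hv.
Qed.

(** Reflection in the diagonal. It reverses orientation, so it is not part of the SL(2, Z) action,
    but it preserves straight segments and zeros. *)
Lemma Hol_swap (R : realType) (N : nat) (h v : 'S_N) (x y : R) :
  Hol (TSurf h v 1%:M) (vec2 x y) -> Hol (TSurf v h 1%:M) (vec2 y x).
Proof.
case=> xy0 [p [q [zp zq pq]]].
pose phi (p : Defs.point R N) := (p.1, vec2 (yco p.2) (xco p.2)) : Defs.point R N.
have phi_zero h' v' p' : is_zero (TSurf h' v' 1%:M) p' ->
  is_zero (TSurf v' h' 1%:M) (phi p').
  by case: p' => i z; rewrite [z]vec2E => /swap_zero; rewrite /phi /= !vec2co.
apply: (Hol_mod _ (phi_zero _ _ _ zp) (phi_zero _ _ _ zq)) => [/vec2_eq0[y0 x0]|].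
  by apply/xy0/vec2_eq0.
apply: (straight_map (S := TSurf h v 1%:M)) pq => {p q zp zq} [p q|[i z] _|].
- elim=> {p q} [i t ht|i t ht|p|p q _|p q r _ h1 _ h2]; rewrite /phi /= ?vec2co.
  + exact: (glued_v (TSurf v h 1%:M)).
  + exact: (glued_h (TSurf v h 1%:M)).
  + exact: glued_refl.
  + exact: glued_sym.
  + exact: glued_trans h1 h2.
- by move/phi_zero; rewrite /phi /= !vec2co -vec2E.
move=> i z z' l; rewrite [z]vec2E [z']vec2E /in_square /= !vec2co => zs zs' l0.
rewrite mul1mx vec2N vec2D vec2Z => /vec2_inj[ex ey].
do 2!eexists; split; [exact: glued_refl..|]; rewrite /phi /= !vec2co.
apply: straight_piece; rewrite /in_square /= ?vec2co //.
- by rewrite andbC.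
- by rewrite andbC.
- by rewrite mul1mx vec2N vec2D vec2Z ex ey.
Qed.

Lemma singular_shear (N : nat) (h v : 'S_N) i : singular h (h * v)%g i = singular h v i.
Proof.
rewrite /singular; suff -> : [~ h * v, h]%g = [~ v, h]%g by [].
by rewrite !commgEl /conjg invMg !mulgA mulgKV.
Qed.

(* The parallelogram with sides (1, 0) and (1, 1) at the lower-left corner of
   square [i] consists of the lower triangle of [i] and the upper triangle of
   [h i]; these parallelograms are the squares of the surface (h, h * v). *)
Definition shear (R : realType) (N : nat) (h : 'S_N) (p : Defs.point R N) :
  Defs.point R N :=
  let s := xco p.2 + yco p.2 in
  if s <= 1 then (p.1, vec2 s (yco p.2)) else (h p.1, vec2 (s - 1) (yco p.2)).

Lemma shear_glued (R : realType) (N : nat) (h v : 'S_N) p q :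
  glued (TSurf h (h * v)%g 1%:M) p q ->
  glued (TSurf h v 1%:M) (@shear R N h p) (shear h q).
Proof.
set S := TSurf h v _.
elim=> {p q} [i y /= /andP[y0 y1]|i x /= /andP[x0 x1]|p|p q _|p q r _ h1 _ h2].
- rewrite /shear /= !vec2co add0r y1; case: ifP => hy.
    have -> : y = 0 by lra.
    by rewrite addr0; apply: (glued_h S); rewrite lexx ler01.
  by rewrite [1 + y]addrC addrK; exact: glued_refl.
- rewrite /shear /= !vec2co addr0 x1 permM; case: ifP => hx.
    have -> : x = 0 by lra.
    rewrite add0r; apply: (@glued_trans _ _ _ _ (h i, vec2 0 1)).
      by apply: (glued_h S); rewrite lexx ler01.
    by apply: (glued_v S); rewrite lexx ler01.
  by rewrite addrK; apply: (glued_v S); rewrite x0 x1.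
- exact: glued_refl.
- exact: glued_sym.
- exact: glued_trans h1 h2.
Qed.

Lemma shear_zero (R : realType) (N : nat) (h v : 'S_N) (p : Defs.point R N) :
  in_square p ->
  is_zero (TSurf h v 1%:M) (shear h p) <-> is_zero (TSurf h (h * v)%g 1%:M) p.
Proof.
case: p => i z; rewrite [z]vec2E; move: (xco z) (yco z) => x y.
rewrite /in_square /= !vec2co => /andP[/andP[x0 x1] /andP[y0 y1]].
split=> /is_zeroE[[j [a b]] e sc]; last first.
  case: e sc => <- /vec2_inj[/= ex ey] /= sc; apply/is_zeroE;
    rewrite /shear /= !vec2co ex ey.
  rewrite singular_shear in sc.
  case: a b {ex ey} sc => [] [] /=; rewrite /corner_rep /= ?permM => sc.
  - rewrite (_ : (1 + 1 <= 1 :> R) = false); last by apply/negbTE; rewrite -ltNge; lra.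
    by exists (h i, (true, true)); rewrite //= addrK.
  - by rewrite addr0 lexx; exists (i, (true, false)).
  - by rewrite add0r lexx; exists (i, (true, true)).
  - by rewrite addr0 ler01; exists (i, (false, false)).
move: e sc; rewrite /shear /= !vec2co.
case: ifP => xy [<- /vec2_inj[/= ex ey]] sc; apply/is_zeroE.
  case: a b ex ey sc => [] [] /= ex ey; rewrite /corner_rep /= => sc.
  - exists (i, (false, true)); last by rewrite singular_shear permM.
    by rewrite /corner /=; congr (_, vec2 _ _); lra.
  - exists (i, (true, false)); last by rewrite singular_shear.
    by rewrite /corner /=; congr (_, vec2 _ _); lra.
  - lra.
  - exists (i, (false, false)); last by rewrite singular_shear.
    by rewrite /corner /=; congr (_, vec2 _ _); lra.
(* Beyond the antidiagonal the only corner left is (1, 1); the other cases contradict the bounds on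
   [x] and [y]. *)
case: a b ex ey sc => [] [] /= ex ey; rewrite /corner_rep /= => sc; try lra.
exists (i, (true, true)); last by rewrite singular_shear permM.
by rewrite /corner /=; congr (_, vec2 _ _); lra.
Qed.

Lemma straight_modN (R : realType) (N : nat) (S : tsurf R N) u p q l :
  straight_mod S u p q l -> straight_mod S (- u) q p l.
Proof. by move=> [p' [q' [pp' qq' h]]]; exists q', p'; split=> //;
  exact: straight_rev. Qed.

(** The antidiagonal x + y = 1 cuts the source square into two triangles, which land in [i] and in
    [h i]. A segment not contained in one closed triangle crosses that line once, so three cases
    suffice. *)
Lemma shear_piece (R : realType) (N : nat) (h v : 'S_N) (i : 'I_N) (x y x' y' a b l : R) :
  0 <= x <= 1 -> 0 <= y <= 1 -> 0 <= x' <= 1 -> 0 <= y' <= 1 -> 0 < l ->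
  x' - x = l * a -> y' - y = l * b ->
  straight_mod (TSurf h v 1%:M) (vec2 (a + b) b)
    (shear h (i, vec2 x y)) (shear h (i, vec2 x' y')) l.
Proof.
set S := TSurf h v _.
have piece j s t s' t' a' b' m : 0 <= s <= 1 -> 0 <= t <= 1 -> 0 <= s' <= 1 ->
    0 <= t' <= 1 -> 0 < m -> s' - s = m * a' -> t' - t = m * b' ->
    straight S (vec2 a' b') (j, vec2 s t) (j, vec2 s' t') m.
  move=> hs ht hs' ht' m0 ea eb.
  apply: straight_piece; rewrite /in_square /= ?vec2co ?hs ?hs' ?ht //.
  by rewrite mul1mx vec2N vec2D vec2Z ea eb.
have low (s t : R) : s + t <= 1 -> shear h (i, vec2 s t) = (i, vec2 (s + t) t).
  by rewrite /shear /= !vec2co => ->.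
have high s t : 0 <= t <= 1 -> 1 <= s + t ->
    glued S (shear h (i, vec2 s t)) (h i, vec2 (s + t - 1) t).
  move=> ht st; rewrite /shear /= !vec2co; case: ifP => st'; last exact: glued_refl.
  have -> : s + t = 1 by lra.
  by rewrite subrr; exact: (glued_h S).
(* Reversing the segment, one may assume that it runs from the lower triangle towards the upper
   one. *)
wlog lehalf : x y x' y' a b / x + y <= x' + y' => [th|].
  move=> hx hy hx' hy' l0 ea eb; have [/th|/ltW /th] := lerP (x + y) (x' + y');
    first exact.
  move=> th'; rewrite -[vec2 _ _]opprK vec2N opprD.
  by apply/straight_modN/th'; rewrite // mulrN -?ea -?eb opprB.
move=> hx hy hx' hy' l0 ea eb.
have [le1|gt1] := lerP (x' + y') 1.
  rewrite !low //; last exact: le_trans lehalf le1.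
  by do 2!eexists; split; [exact: glued_refl..|]; apply: piece => //; lra.
have [ge1|lt1] := lerP 1 (x + y).
  exists (h i, vec2 (x + y - 1) y), (h i, vec2 (x' + y' - 1) y').
  by split; [apply: high => //; lra..|]; apply: piece => //; lra.
(* The segment crosses the right side of square [i] at height [w]. *)
pose r := (1 - (x + y)) / (x' + y' - (x + y)).
have d0 : 0 < x' + y' - (x + y) by lra.
have r0 : 0 < r by rewrite divr_gt0 //; lra.
have r1 : r < 1 by rewrite ltr_pdivrMr //; lra.
have re : r * (x' + y' - (x + y)) = 1 - (x + y) by rewrite divfK // gt_eqF.
pose w := y + r * (y' - y).
(* The crossing point is not a corner, hence not a zero: height 0 would force y = y' = 0 and x' > 1,
   height 1 would force y = y' = 1 and x < 0. *)
have w0 : 0 < w.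
  rewrite lt_neqAle; apply/andP; split; last by rewrite /w; nra.
  apply/eqP => w0; have := w0; rewrite /w; nra.
have w1 : w < 1 by rewrite /w; nra.
have -> : l = l * r + l * (1 - r) by ring.
apply: (@straight_mod_cat _ _ _ _ _ (i, vec2 1 w) (h i, vec2 0 w)).
- rewrite low; last by lra.
  by do 2!eexists; split; [exact: glued_refl..|]; apply: piece; rewrite /w; nra.
- by apply: (glued_h S); rewrite !ltW.
- move=> /is_zeroE[[j [c d]] [_ /vec2_inj[_ wd]] _].
  by case: d wd => wd; move: w0 w1; rewrite wd ?ltxx.
exists (h i, vec2 0 w), (h i, vec2 (x' + y' - 1) y'); split; first exact: glued_refl.
  by apply: high => //; lra.
by apply: piece; rewrite /w; nra.
Qed.

Lemma Hol_shear (R : realType) (N : nat) (h v : 'S_N) (x y : R) :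
  Hol (TSurf h (h * v)%g 1%:M) (vec2 x y) -> Hol (TSurf h v 1%:M) (vec2 (x + y) y).
Proof.
case=> xy0 [p [q [zp zq pq]]].
have [ps qs _] := straight_in_square pq.
apply: (Hol_mod _ ((shear_zero h v ps).2 zp) ((shear_zero h v qs).2 zq)).
  by move=> /vec2_eq0[+ y0]; rewrite y0 addr0 => x0; apply/xy0/vec2_eq0.
apply: (straight_map (S := TSurf h (h * v)%g 1%:M)) pq => [p' q'|q' q's|].
- exact: shear_glued.
- by move/(shear_zero _ _ q's).
move=> i z z' l; rewrite [z]vec2E [z']vec2E /in_square /= !vec2co.
move=> /andP[zx zy] /andP[zx' zy'] l0; rewrite mul1mx vec2N vec2D vec2Z => /vec2_inj[ex
  ey].
exact: shear_piece.
Qed.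

(** * Short saddle connections *)

Lemma perm_pigeonhole (T : finType) (Z : {set T}) (f g : {perm T}) :
  (#|T| < 3 * #|Z|)%N ->
  exists2 z, z \in Z & [\/ f z \in Z, g z \in Z | exists2 z', z' \in Z & f z = g z'].
Proof.
move=> cardT; apply: contrapT => noz.
have disj (A B : {set T}) : (forall z, z \in A -> z \in B -> False) ->
  A :&: B = finset.set0.
  move=> AB; apply/finset.setP => z; rewrite finset.in_setI finset.in_set0.
  by apply/negP => /andP[zA /(AB z zA)].
have fZ : Z :&: [set f z | z in Z] = finset.set0.
  apply: disj => _ /[swap] /imsetP[z zZ ->] fz; apply: noz.
  by exists z => //; constructor 1.
have gZ : Z :&: [set g z | z in Z] = finset.set0.
  apply: disj => _ /[swap] /imsetP[z zZ ->] fz; apply: noz.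
  by exists z => //; constructor 2.
have fgZ : [set f z | z in Z] :&: [set g z | z in Z] = finset.set0.
  apply: disj => _ /imsetP[z zZ ->] /imsetP[z' zZ' e]; apply: noz.
  by exists z => //; constructor 3; exists z'.
suff : (3 * #|Z| <= #|T|)%N by rewrite leqNgt cardT.
have -> : (3 * #|Z| = #|Z :|: ([set f z | z in Z] :|: [set g z | z in Z])|)%N.
  rewrite !cardsU fgZ finset.setIUr fZ gZ finset.setU0 finset.cards0 !subn0.
  by rewrite !card_imset; try exact: perm_inj; lia.
exact: max_card.
Qed.

Lemma corner_zero (R : realType) (N : nat) (h v : 'S_N) i b b' :
  singular h v (corner_rep h v (i, (b, b'))) ->
  is_zero (TSurf h v 1%:M) (i, vec2 (b%:R : R) b'%:R).
Proof. by move=> s; apply/is_zeroE; exists (i, (b, b')). Qed.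

Lemma straight_corner (R : realType) (N : nat) (h v : 'S_N) i (x y l a b : R) :
  0 <= x <= 1 -> 0 <= y <= 1 -> 0 < l -> l * a = x -> l * b = y ->
  straight (TSurf h v 1%:M) (vec2 a b) (i, vec2 0 0) (i, vec2 x y) l.
Proof.
move=> hx hy l0 ea eb; apply: straight_piece;
  rewrite /in_square /= ?vec2co ?lexx ?ler01 ?hx//.
by rewrite mul1mx vec2N vec2D vec2Z ea eb !subr0.
Qed.

Lemma Hol_horizontal (R : realType) (N : nat) (h v : 'S_N) z :
  singular h v z -> singular h v (h z) -> Hol (TSurf h v 1%:M) (vec2 (1 : R) 0).
Proof.
move=> sz shz; split; first by case/vec2_eq0 => /eqP; rewrite oner_eq0.
exists (z, vec2 0 0), (z, vec2 1 0); split.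
- exact: (@corner_zero _ _ _ _ _ false false).
- exact: (@corner_zero _ _ _ _ _ true false).
- by apply: straight_corner; rewrite ?lexx ?ler01 ?mul1r.
Qed.

Lemma Hol_diagonal (R : realType) (N : nat) (h v : 'S_N) z :
  singular h v z -> singular h v (v (h z)) -> Hol (TSurf h v 1%:M) (vec2 (1 : R) 1).
Proof.
move=> sz shz; split; first by case/vec2_eq0 => /eqP; rewrite oner_eq0.
exists (z, vec2 0 0), (z, vec2 1 1); split.
- exact: (@corner_zero _ _ _ _ _ false false).
- exact: (@corner_zero _ _ _ _ _ true true).
- by apply: straight_corner; rewrite ?lexx ?ler01 ?mul1r.
Qed.

Lemma Hol_horizontal2 (R : realType) (N : nat) (h v : 'S_N) z :
  singular h v z -> ~~ singular h v (h z) -> singular h v (h (h z)) ->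
  Hol (TSurf h v 1%:M) (vec2 (2 : R) 0).
Proof.
move=> sz shz shhz; split; first by case/vec2_eq0 => /eqP; rewrite pnatr_eq0.
exists (z, vec2 0 0), (h z, vec2 1 0); split.
- exact: (@corner_zero _ _ _ _ _ false false).
- exact: (@corner_zero _ _ _ _ _ true false).
(* Each of the two unit sides is half of the vector (2, 0), hence has parameter 1/2. *)
- have half : 2^-1 * 2 = 1 :> R by rewrite mulVf// pnatr_eq0.
  have e : 2^-1 + 2^-1 = 1 :> R by lra.
  rewrite -[X in straight _ _ _ _ X]e.
  apply: (@straight_cat _ _ _ _ _ (z, vec2 1 0) (h z, vec2 0 0)).
  + by apply: straight_corner; rewrite ?lexx ?ler01 ?half ?mulr0 ?invr_gt0.
  + by apply: (glued_h (TSurf h v 1%:M)); rewrite lexx ler01.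
  + move=> /is_zeroE[[i [a b]] [<- /vec2_inj[/= ea eb]]].
    case: a ea => [_|/eqP]; last by rewrite oner_eq0.
    by case: b eb => [/esym/eqP|_]; rewrite ?oner_eq0// /corner_rep /= (negbTE shz).
  + by apply: straight_corner; rewrite ?lexx ?ler01 ?half ?mulr0 ?invr_gt0.
Qed.

Lemma Hol_horizontal_le2 (R : realType) (N : nat) (h v : 'S_N) :
  (N < 3 * #|singular h v|)%N ->
  Hol (TSurf h v 1%:M) (vec2 (1 : R) 0) \/ Hol (TSurf h v 1%:M) (vec2 (2 : R) 0).
Proof.
move=> hN; pose Z := [set z | singular h v z]%SET.
have inZ z : (z \in Z) = singular h v z by rewrite finset.in_set.
have [|z zZ] := @perm_pigeonhole _ Z h (h * h)%g; first by rewrite cardsE card_ord.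
rewrite !inZ permM in zZ * => -[shz|shhz|[z' z'Z]].
- by left; exact: Hol_horizontal shz.
- have [shz|nshz] := boolP (singular h v (h z)); first by left; exact: Hol_horizontal shz.
  by right; exact: Hol_horizontal2 shhz.
(* Here [h z = h (h z')], so [z = h z'], and the bottom side of [z'] joins two zeros. *)
- rewrite permM => /perm_inj e; left; rewrite inZ in z'Z.
  by apply: Hol_horizontal z'Z _; rewrite -e.
Qed.

Lemma Hol_unit_parallelogram (R : realType) (N : nat) (h v : 'S_N) :
  (N < 3 * #|singular h v|)%N ->
  [\/ Hol (TSurf h v 1%:M) (vec2 (1 : R) 0), Hol (TSurf h v 1%:M) (vec2 (0 : R) 1)
    | Hol (TSurf h v 1%:M) (vec2 (1 : R) 1)].
Proof.
move=> hN; pose Z := [set z | singular h v z]%SET.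
have inZ z : (z \in Z) = singular h v z by rewrite finset.in_set.
have vert z : singular h v z -> singular h v (v z) ->
    Hol (TSurf h v 1%:M) (vec2 (0 : R) 1).
  by move=> sz svz; apply/Hol_swap; apply: (@Hol_horizontal _ _ _ _ z); rewrite singularC.
(* [v * h] sends [z] to [h (v z)], which is singular exactly when the upper-right corner of [z] is a
   zero; a coincidence [h z = h (v z')] gives a vertical side joining two zeros. *)
have [|z zZ] := @perm_pigeonhole _ Z h (v * h)%g; first by rewrite cardsE card_ord.
rewrite !inZ permM in zZ * => -[shz|shvz|[z' z'Z]].
- by constructor 1; exact: Hol_horizontal shz.
- by constructor 3; apply: Hol_diagonal zZ _; rewrite -singular_hv.
- rewrite permM => /perm_inj e; constructor 2; rewrite inZ in z'Z.
  by apply: vert z'Z _; rewrite -e.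
Qed.

Lemma card_singular_shear (N : nat) (h v : 'S_N) :
  #|singular h (h * v)%g| = #|singular h v|.
Proof. by apply: eq_card => i; exact: singular_shear. Qed.

Lemma card_singularC (N : nat) (h v : 'S_N) : #|singular v h| = #|singular h v|.
Proof. by apply: eq_card => i; exact: singularC. Qed.

(* Euclid's algorithm on the two vectors: subtracting one coordinate from the
   other is a shear, which does not change the set of singular squares. *)
Lemma Hol_basis (R : realType) (N : nat) (h v : 'S_N) (x y x' y' : nat) :
  (N < 3 * #|singular h v|)%N ->
  (x * y' = (y * x').+1 \/ y * x' = (x * y').+1)%N ->
  let H (a b : nat) := Hol (TSurf h v 1%:M) (vec2 (a%:R : R) b%:R) in
  (H x y \/ H (2 * x)%N (2 * y)%N) /\ [\/ H x y, H x' y' | H (x + x')%N (y + y')%N].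
Proof.
have [n] := ubnP (x + y + x' + y'); elim: n h v x y x' y' => // n IH h v x y x' y' le_n.
move=> hN det H.
(* Both vectors are then shears of smaller ones. The sum of the entries drops, since y = y' = 0
   would make the determinant vanish. *)
have [/andP[yx yx']|ne1] := boolP ((y <= x) && (y' <= x'))%N.
  have shearH a b c : (a + b = c)%N ->
      Hol (TSurf h (h * v)%g 1%:M) (vec2 (a%:R : R) b%:R) -> H c b.
    by move=> <-; rewrite /H natrD; exact: Hol_shear.
  have [|||m2 m3] := IH h (h * v)%g (x - y)%N y (x' - y')%N y'.
  - by nia.
  - by rewrite card_singular_shear.
  - by nia.
  - split; first by case: m2 => /shearH m2; [left|right]; apply: m2; lia.
    by case: m3 => /shearH m3; [constructor 1|constructor 2|constructor 3]; apply: m3;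
      lia.
have [/andP[xy xy']|ne2] := boolP ((x <= y) && (x' <= y'))%N.
  have shearH a b c : (b + a = c)%N ->
      Hol (TSurf v (v * h)%g 1%:M) (vec2 (b%:R : R) a%:R) -> H a c.
    by move=> <- /Hol_shear; rewrite /H natrD; exact: Hol_swap.
  have [|||m2 m3] := IH v (v * h)%g (y - x)%N x (y' - x')%N x'.
  - by nia.
  - by rewrite card_singular_shear card_singularC.
  - by nia.
  - split; first by case: m2 => /shearH m2; [left|right]; apply: m2; lia.
    by case: m3 => /shearH m3; [constructor 1|constructor 2|constructor 3]; apply: m3;
      lia.
(* The two vectors are now on opposite sides of the diagonal, and determinant 1 or -1 leaves only
   the standard basis, in one of its two orders. *)
have := Hol_unit_parallelogram R hN; have := Hol_horizontal_le2 R hN.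
have : Hol (TSurf h v 1%:M) (vec2 (0 : R) 1) \/ Hol (TSurf h v 1%:M) (vec2 (0 : R) 2).
  by have := @Hol_horizontal_le2 R N v h; rewrite card_singularC => /(_ hN)[]/Hol_swap;
    [left|right].
have [[-> -> -> ->]|[-> -> -> ->]] :
    [/\ x = 1, y = 0, x' = 0 & y' = 1]%N \/ [/\ x = 0, y = 1, x' = 1 & y' = 0]%N.
- move: ne1 ne2; rewrite !negb_and -!ltnNge => /orP[xy|xy'] /orP[yx|yx']; try lia.
    have [x0 y'0] : x = 0%N /\ y' = 0%N by nia.
    by right; move: det; rewrite x0 y'0 muln0 => -[//|/eqP];
      rewrite muln_eq1 => /andP[/eqP-> /eqP->].
  have [y0 x'0] : y = 0%N /\ x' = 0%N by nia.
  by left; move: det; rewrite y0 x'0 muln0 => -[/eqP|//];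
    rewrite muln_eq1 => /andP[/eqP-> /eqP->].
- move=> _ hor par; split; first by case: hor; [left|right].
  by case: par; [constructor 1|constructor 2|constructor 3].
- move=> ver _ par; split; first by case: ver; [left|right].
  by case: par; [constructor 2|constructor 1|constructor 3].
Qed.

(** * Integrality of the periods *)

Definition ivec (R : realType) (u : 'cV[R]_2) : Prop :=
  exists a b : int, u = vec2 a%:~R b%:~R.

Lemma ivecD (R : realType) (u v : 'cV[R]_2) : ivec u -> ivec v -> ivec (u + v).
Proof.
by move=> [a [b ->]] [c [d ->]]; exists (a + c), (b + d); rewrite vec2D !intrD.
Qed.

Lemma ivecN (R : realType) (u : 'cV[R]_2) : ivec u -> ivec (- u).
Proof. by move=> [a [b ->]]; exists (- a), (- b); rewrite vec2N !intrN. Qed.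

Lemma glued_ivec (R : realType) (N : nat) (S : tsurf R N) p q :
  glued S p q -> ivec (p.2 - q.2).
Proof.
elim=> {p q} [i y _|i x _|p|p q _ h|p q r _ h1 _ h2] /=.
- by exists 1, 0; rewrite vec2N vec2D subr0 subrr.
- by exists 0, 1; rewrite vec2N vec2D subr0 subrr.
- by exists 0, 0; rewrite subrr; apply/esym/vec2_eq0.
- by rewrite -opprB; exact: ivecN.
- by rewrite -(subrKA q.2); exact: ivecD.
Qed.

(** Each passage through a gluing replaces the representative by an integer translate, so the
    displacement of the representatives differs from the integral of [w] by an integer vector. *)
Lemma straight_ivec (R : realType) (N : nat) (S : tsurf R N) u p q l :
  frame S = 1%:M -> straight S u p q l -> ivec (q.2 - p.2 - l *: u).
Proof.
move=> f1; elim=> {p q l} [i z z' l _ _ _|p q q' r l m _ h1 qq' _ _ h2].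
  rewrite f1 mul1mx => <-; rewrite /= subrr; exists 0, 0.
  exact/esym/vec2_eq0.
have -> : r.2 - p.2 - (l + m) *: u =
    (q.2 - p.2 - l *: u) + (r.2 - q'.2 - m *: u) - (q.2 - q'.2).
  by apply/matrixP => i j; rewrite !mxE; ring.
by apply: ivecD; [exact: ivecD|apply: ivecN; exact: glued_ivec qq'].
Qed.

Lemma is_zero_ivec (R : realType) (N : nat) (S : tsurf R N) p :
  is_zero S p -> ivec p.2.
Proof. by move=> /is_zeroE[[i [a b]] -> _]; exists a%:Z, b%:Z. Qed.

Lemma Hol_ivec (R : realType) (N : nat) (S : tsurf R N) u :
  frame S = 1%:M -> Hol S u -> ivec u.
Proof.
move=> f1 [_ [p [q [zp zq /(straight_ivec f1)]]]]; rewrite scale1r => h.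
have -> : u = (q.2 - p.2) - (q.2 - p.2 - u) by rewrite subKr.
apply: ivecD (ivecN h); apply: ivecD; first exact: is_zero_ivec zq.
by apply: ivecN; exact: is_zero_ivec zp.
Qed.

Lemma enorm_vec2 (R : realType) (x y : R) : enorm (vec2 x y) = Num.sqrt (x ^+ 2 + y ^+ 2).
Proof. by rewrite /enorm !vec2co. Qed.

Lemma enorm_ge0 (R : realType) (u : 'cV[R]_2) : 0 <= enorm u.
Proof. exact: sqrtr_ge0. Qed.

Lemma inf_min (R : realType) (A : set R) m :
  A m -> (forall x, A x -> m <= x) -> inf A = m.
Proof.
move=> Am lbm; apply/eqP; rewrite eq_le; apply/andP; split.
  by apply: ge_inf => //; exists m.
by apply: lb_le_inf => //; exists m.
Qed.

Lemma intr_norm_ge1 (R : realType) (k : int) : k != 0 -> 1 <= `|k%:~R : R|.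
Proof. by move=> k0; rewrite -intr_norm (ler_int R 1) -gtz0_ge1 normr_gt0. Qed.

Lemma intr_norm_ge2 (R : realType) (k : int) :
  k != 0 -> k != 1 -> k != -1 -> 2 <= `|k%:~R : R|.
Proof. by move=> k0 k1 kN1; rewrite -intr_norm (ler_int R 2); lia. Qed.

(* [(c, d)] is only a Bezout witness of the primitivity of [(x, y)]. *)
Lemma hmult_eq (R : realType) (N : nat) (S : tsurf R N) (M : 'M[R]_2) (x y s : R) (c d :
  int) :
  frame S = 1%:M -> M \in unitmx -> s ^+ 2 = 1 -> M *m vec2 x y = vec2 s 0 ->
  c%:~R * x + d%:~R * y = 1 ->
  Hol S (vec2 x y) \/ Hol S (vec2 (2 * x) (2 * y)) ->
  hmult (surf_act M S) = if `[< Hol S (vec2 x y) >] then 1 else 2.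
Proof.
move=> f1 Mu s1 Mv bez h12.
have inv u : Hol (surf_act M S) u -> yco u = 0 ->
    exists2 k : int, k != 0 & Hol S (vec2 (k%:~R * x) (k%:~R * y)) /\ enorm u = `|k%:~R|.
  (* [t] is the ratio of [w] to [vec2 x y], because [s] is its own inverse; the Bezout relation
     makes it an integer. *)
  rewrite Hol_actE// => -[w wS <-] uy; pose t := s * xco (M *m w).
  have Mw : M *m w = M *m vec2 (t * x) (t * y).
    rewrite -vec2Z -scalemxAr Mv vec2Z mulr0 {1}(vec2E (M *m w)) uy /t.
    by rewrite mulrAC -expr2 s1 mul1r.
  have wE : w = vec2 (t * x) (t * y) by rewrite -(mulKmx Mu w) Mw mulKmx.
  have [a [b]] := Hol_ivec f1 wS; rewrite {1}wE => /vec2_inj[ea eb].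
  have tE : t = (c * a + d * b)%:~R.
    by rewrite intrD !intrM -ea -eb !(mulrCA _ t) -mulrDr bez mulr1.
  exists (c * a + d * b); last rewrite -tE.
    apply/eqP => k0; case: wS => w0 _; apply: w0; rewrite wE tE k0 !mul0r.
    exact/vec2_eq0.
  rewrite -wE; split => //; rewrite /enorm uy expr0n /= addr0 sqrtr_sqr /t normrM.
  suff -> : `|s| = 1 by rewrite mul1r.
  by apply/eqP; rewrite -[_ == _](@eqrXn2 _ 2)// ?expr1n// real_normK ?num_real// s1.
have wit (k : nat) : (0 < k)%N -> Hol S (vec2 (k%:R * x) (k%:R * y)) ->
    (@enorm R @` [set u | Hol (surf_act M S) u /\ yco u = 0]) k%:R.
  move=> k0 hk; exists (vec2 (k%:R * s) 0); last first.
    by rewrite enorm_vec2 expr0n /= addr0 exprMn s1 mulr1 sqrtr_sqr normr_nat.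
  split; last by rewrite vec2co.
  rewrite Hol_actE//; exists (vec2 (k%:R * x) (k%:R * y)) => //.
  by rewrite -vec2Z -scalemxAr Mv vec2Z mulr0.
case: asboolP => hv; apply: inf_min.
- by apply: (wit 1%N); rewrite ?mul1r.
- by move=> _ [u [uS uy] <-]; have [k k0 [_ ->]] := inv u uS uy; exact: intr_norm_ge1.
- by case: h12 => // h2; apply: (wit 2%N).
- move=> _ [u [uS uy] <-]; have [k k0 [kS ->]] := inv u uS uy.
  apply: intr_norm_ge2 => //; apply/eqP => k1; apply: hv.
    by move: kS; rewrite k1 !mul1r.
  by move: kS => /Hol_opp; rewrite k1 vec2N !mulN1r !opprK.
Qed.

(** * Continued fractions *)

(** The value when the last partial quotient is increased by [x]; it exposes the dependence on the
    tail, on which convergence rests. *)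
Definition cfx (R : realType) (s : seq nat) (x : R) : R :=
  foldr (fun a x => (a%:R + x)^-1) x s.

Lemma cf_cat (R : realType) (s t : seq nat) : cf R (s ++ t) = cfx s (cf R t).
Proof. exact: foldr_cat. Qed.

Definition all_pos (s : seq nat) := all (ltn 0) s.

Lemma cfx_itv (R : realType) (s : seq nat) (x : R) :
  all_pos s -> 0 <= x <= 1 -> 0 <= cfx s x <= 1.
Proof.
elim: s => //= b s IH /andP[b0 /IH {}IH] /IH /andP[y0 _].
have b1 : 1 <= b%:R :> R by rewrite ler1n.
by rewrite invr_ge0 addr_ge0 ?ler0n//= invf_le1; lra.
Qed.

Lemma inv_dist (R : realType) (b : nat) (x y : R) : (0 < b)%N ->
  0 <= x -> 0 <= y -> `|(b%:R + x)^-1 - (b%:R + y)^-1| = `|x - y| / ((b%:R + x) * (b%:R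
    + y)).
Proof.
move=> b0 x0 y0; have {}b0 : 1 <= b%:R :> R by rewrite ler1n.
have bx : 0 < b%:R + x by lra.
have by' : 0 < b%:R + y by lra.
have -> : (b%:R + x)^-1 - (b%:R + y)^-1 = (y - x) / ((b%:R + x) * (b%:R + y)).
  by field; rewrite !gt_eqF.
by rewrite normrM normfV distrC [X in _ / X]ger0_norm// mulr_ge0 ?ltW.
Qed.

(* The map x |-> 1 / (b + 1 / (c + x)) contracts distances by a factor 4. *)
Lemma cfx_dist (R : realType) (s : seq nat) (x y : R) :
  all_pos s -> 0 <= x <= 1 -> 0 <= y <= 1 ->
  `|cfx s x - cfx s y| <= 2 / 2 ^+ size s.
Proof.
move=> + x01 y01; have [n] := ubnP (size s); elim: n s => // n IH [|b [|c s]] /=.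
- by move=> _ _; rewrite expr0 divr1 ler_norml; lra.
- rewrite andbT => _ b0; rewrite expr1 divff ?pnatr_eq0//.
  have b1 : 1 <= b%:R :> R by rewrite ler1n.
  rewrite inv_dist//; [|lra..].
  rewrite ler_pdivrMr; last by nra.
  by rewrite mul1r (@le_trans _ _ 1)//; [rewrite ler_norml; lra|nra].
move=> le_n /and3P[b0 c0 ps].
have /andP[X0 X1] := cfx_itv ps x01; have /andP[Y0 Y1] := cfx_itv ps y01.
have {IH} := IH s (ltnW le_n) ps; set X := cfx s x in X0 X1 *;
  set Y := cfx s y in Y0 Y1 *.
move=> IH.
have b1 : 1 <= b%:R :> R by rewrite ler1n.
have c1 : 1 <= c%:R :> R by rewrite ler1n.
have cX : 0 < c%:R + X by lra.
have cY : 0 < c%:R + Y by lra.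
rewrite inv_dist//; [|by rewrite invr_ge0 ltW..].
rewrite inv_dist// -mulrA -invfM.
have -> : (c%:R + X) * (c%:R + Y) * ((b%:R + (c%:R + X)^-1) * (b%:R + (c%:R + Y)^-1)) =
    (b%:R * (c%:R + X) + 1) * (b%:R * (c%:R + Y) + 1) by field; rewrite !gt_eqF.
have : 2 <= b%:R * (c%:R + X) + 1 by nra.
have : 2 <= b%:R * (c%:R + Y) + 1 by nra.
move: (b%:R * _ + 1) (b%:R * _ + 1) => B A B2 A2.
have AB : 4 <= B * A by nra.
apply: (@le_trans _ _ (`|X - Y| / 4)).
  by rewrite ler_wpM2l// lef_pV2 ?posrE; lra.
have -> : 2 ^+ (size s).+2 = 2 ^+ size s * 4 :> R by rewrite !exprS; ring.
by rewrite invfM mulrA ler_wpM2r// invr_ge0.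
Qed.

Lemma cf_itv (R : realType) (s : seq nat) : all_pos s -> 0 <= cf R s <= 1.
Proof. by move=> ps; apply: (@cfx_itv _ _ 0) => //; rewrite lexx ler01. Qed.

Lemma all_pos_mkseq (b : nat -> nat) n : (forall k, 0 < b k)%N -> all_pos (mkseq b n).
Proof. by move=> b0; apply/allP => _ /mapP[k _ ->]; exact: b0. Qed.

Lemma is_cvg_cf (R : realType) (b : nat -> nat) : (forall k, 0 < b k)%N ->
  cvgn (fun n => cf R (mkseq b n)).
Proof.
move=> b0; apply: cauchy_cvg; apply: cauchy_exP => e e0.
have [n ne] : exists n, 2 / 2 ^+ n < e.
  exists (Num.Def.archi_bound (2 / e)).
  rewrite ltr_pdivrMr ?exprn_gt0// mulrC -ltr_pdivrMr//.
  apply: (lt_le_trans (archi_boundP _)); first by rewrite divr_ge0 ?ltW.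
  by rewrite -natrX ler_nat ltnW// ltn_expl.
exists (cf R (mkseq b n)); exists n => // m /= nm.
rewrite /ball /=; apply: le_lt_trans ne.
(* The two expansions share their first [n] quotients and differ only in the tail, which is 0 for
   the shorter one. *)
rewrite -(subnKC nm) /mkseq iotaD map_cat cf_cat -/(mkseq b n).
have -> : 2 / 2 ^+ n = 2 / 2 ^+ size (mkseq b n) :> R by rewrite size_mkseq.
apply: (@cfx_dist _ _ 0); rewrite ?lexx ?ler01//; first exact: all_pos_mkseq.
by apply: cf_itv; apply/allP => _ /mapP[k _ ->]; exact: b0.
Qed.

Lemma cf_inf_ge0 (R : realType) (b : nat -> nat) : (forall k, 0 < b k)%N ->
  0 <= cf_inf R b.
Proof.
move=> b0; apply: limr_ge; first exact: is_cvg_cf.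
by apply: nearW => n; have /andP[] := cf_itv R (all_pos_mkseq n b0).
Qed.

Lemma cf_infS (R : realType) (b : nat -> nat) : (forall k, 0 < b k)%N ->
  cf_inf R b = ((b 0)%:R + cf_inf R (fun k => b k.+1))^-1.
Proof.
move=> b0; have b1 k : (0 < b k.+1)%N by [].
have h : cf R (mkseq (fun k => b k.+1) n) @[n --> \oo] --> cf_inf R (fun k => b k.+1).
  exact: is_cvg_cf.
apply: cvg_lim => //; rewrite -cvg_shiftS /=.
rewrite (_ : (fun n => _) = fun n => ((b 0)%:R + cf R (mkseq (fun k => b k.+1) n))^-1);
  last first.
  by apply/funext => n; rewrite /mkseq /= -[1%N]/(1 + 0)%N iotaDl -map_comp.
apply: cvgV; last exact: cvgD (cvg_cst _) h.
have := cf_inf_ge0 R b1; have : (0 : R) < (b 0)%:R by rewrite ltr0n.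
by move=> *; rewrite gt_eqF//; lra.
Qed.

Lemma cf_inf_itv (R : realType) (b : nat -> nat) : (forall k, 0 < b k)%N ->
  0 < cf_inf R b < 1.
Proof.
move=> b0; have b1 k : (0 < b k.+1)%N by [].
have b01 : 1 <= (b 0)%:R :> R by rewrite ler1n.
have h0 c : (forall k, 0 < c k)%N -> 0 < cf_inf R c.
  move=> c0; have c1 k : (0 < c k.+1)%N by [].
  by rewrite cf_infS// invr_gt0 ltr_pwDl ?ltr0n// cf_inf_ge0.
rewrite h0//= cf_infS//; have := h0 _ b1 => ?.
by rewrite invf_lt1; lra.
Qed.

(* [conv 1 0 a n / conv 0 1 a n] is the convergent [a_1, ..., a_{n-1}]; the
   index is shifted by one so as to start with (1, 0) and (0, 1). *)
Fixpoint conv (c0 c1 : nat) (a : nat -> nat) (n : nat) : nat :=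
  match n with
  | 0 => c0
  | 1 => c1
  | (n'.+1 as m).+1 => a m * conv c0 c1 a m + conv c0 c1 a n'
  end%N.

Lemma convSS c0 c1 a n : conv c0 c1 a n.+2 = (a n.+1 * conv c0 c1 a n.+1 + conv c0 c1 a
  n)%N.
Proof. by []. Qed.

Local Notation convp := (conv 1 0).

Local Notation convq := (conv 0 1).

Lemma conv_det (a : nat -> nat) n :
  if odd n then (convq a n * convp a n.+1 = (convp a n * convq a n.+1).+1)%N
  else (convp a n * convq a n.+1 = (convq a n * convp a n.+1).+1)%N.
Proof.
elim: n => [//|n]; rewrite !convSS /=; case: (odd n) => /= IH; nia.
Qed.

(** [cftail R a 1] is alpha, and [cftail R a n.+1] its image under n steps of the Gauss map. *)
Definition cftail (R : realType) (a : nat -> nat) (n : nat) : R :=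
  cf_inf R (fun k => a (n + k)%N).

(** The product of the first n tails is the distance |p - alpha q| for the convergent of index n, by
    [cferrE]. *)
Fixpoint cferr (R : realType) (a : nat -> nat) (n : nat) : R :=
  if n is m.+1 then cferr R a m * cftail R a m.+1 else 1.

Lemma convq_gt0 (a : nat -> nat) n : (forall n, 0 < n -> 0 < a n)%N ->
  (0 < convq a n.+1)%N.
Proof.
move=> a0; elim: n => // n IH; rewrite convSS ltn_addr// muln_gt0 IH andbT.
exact: a0.
Qed.

Lemma convq_le (a : nat -> nat) n : (forall n, 0 < n -> 0 < a n)%N ->
  (convq a n <= convq a n.+1)%N.
Proof.
move=> a0; case: n => // n; rewrite convSS; have := a0 n.+1 isT.
by nia.
Qed.

Lemma convq_homo (a : nat -> nat) : (forall n, 0 < n -> 0 < a n)%N ->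
  {homo convq a : m n / (m <= n)%N}.
Proof. by move=> a0; apply: homo_leq => [//|? ? ?|n];
  [exact: leq_trans|exact: convq_le]. Qed.

Lemma convq_ge (a : nat -> nat) n : (forall n, 0 < n -> 0 < a n)%N ->
  (n <= convq a n.+1)%N.
Proof.
move=> a0; elim: n => // -[|n] IH; first exact: convq_gt0.
rewrite convSS; have := a0 n.+2 isT; have := convq_gt0 n a0; nia.
Qed.

Lemma cftailS (R : realType) (a : nat -> nat) n : (forall n, 0 < n -> 0 < a n)%N ->
  cftail R a n.+1 = ((a n.+1)%:R + cftail R a n.+2)^-1.
Proof.
move=> a0; rewrite /cftail cf_infS => [|k]; last exact: a0.
by rewrite addn0; congr (_ + cf_inf R _)^-1; apply/funext => k; rewrite addnS.
Qed.

Lemma cftail_itv (R : realType) (a : nat -> nat) n : (forall n, 0 < n -> 0 < a n)%N ->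
  0 < cftail R a n.+1 < 1.
Proof. by move=> a0; apply: cf_inf_itv => k; exact: a0. Qed.

Lemma cferr_gt0 (R : realType) (a : nat -> nat) n : (forall n, 0 < n -> 0 < a n)%N ->
  0 < cferr R a n.
Proof.
move=> a0; elim: n => [|n IH] /=; first exact: ltr01.
by rewrite mulr_gt0//; have /andP[] := cftail_itv R n a0.
Qed.

Lemma cferrSS (R : realType) (a : nat -> nat) n : (forall n, 0 < n -> 0 < a n)%N ->
  cferr R a n = (a n.+1)%:R * cferr R a n.+1 + cferr R a n.+2.
Proof.
move=> a0 /=; have /andP[t0 _] := cftail_itv R n a0.
have e : cftail R a n.+1 * ((a n.+1)%:R + cftail R a n.+2) = 1.
  rewrite {1}cftailS// mulVf// gt_eqF//.
  have /andP[] := cftail_itv R n.+1 a0; have := ler0n R (a n.+1).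
  by move=> *; lra.
move: e; move: (cferr _ _ _) (cftail _ _ _) (cftail _ _ _) => d s t e.
rewrite [RHS](_ : _ = d * (t * ((a n.+1)%:R + s))); last by ring.
by rewrite e mulr1.
Qed.

Lemma cferrE (R : realType) (a : nat -> nat) n : (forall n, 0 < n -> 0 < a n)%N ->
  (convp a n)%:R - cftail R a 1 * (convq a n)%:R = (-1) ^+ n * cferr R a n.
Proof.
move=> a0.
suff : (convp a n)%:R - cftail R a 1 * (convq a n)%:R = (-1) ^+ n * cferr R a n /\
  (convp a n.+1)%:R - cftail R a 1 * (convq a n.+1)%:R = (-1) ^+ n.+1 * cferr R a n.+1
    by case.
elim: n => [|n [IH1 IH2]].
  by rewrite /= expr0 expr1; split; ring.
split=> //; have := cferrSS R n a0; move: IH1 IH2; rewrite !convSS.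
move: (cferr R a n) (cferr R a n.+1) (cferr R a n.+2) => d0 d1 d2.
rewrite !natrD !natrM !exprS => IH1 IH2 e.
have -> : d2 = d0 - (a n.+1)%:R * d1 by rewrite e; ring.
rewrite [LHS](_ : _ = ((convp a n)%:R - cftail R a 1 * (convq a n)%:R) +
  (a n.+1)%:R * ((convp a n.+1)%:R - cftail R a 1 * (convq a n.+1)%:R)); last by ring.
by rewrite IH1 IH2; ring.
Qed.

(** The area of the parallelogram spanned by two consecutive convergents, in the coordinates error
    and height; the errors have opposite signs, so the two products add up. Most estimates on
    heights and errors below come from this identity. *)
Lemma conv_cferr (R : realType) (a : nat -> nat) n : (forall n, 0 < n -> 0 < a n)%N ->
  (convq a n.+1)%:R * cferr R a n + (convq a n)%:R * cferr R a n.+1 = 1.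
Proof.
move=> a0; elim: n => [|n IH]; first by rewrite /=; ring.
rewrite convSS natrD natrM -[RHS]IH (cferrSS R n)//; ring.
Qed.

Lemma cf_cons (R : realType) b s : cf R (b :: s) = (b%:R + cf R s)^-1.
Proof. by []. Qed.

(** The recurrence of the denominators, divided by the previous denominator, unrolls into the
    expansion in reverse order. *)
Lemma cf_revE (R : realType) (a : nat -> nat) n : (forall n, 0 < n -> 0 < a n)%N ->
  cf R [seq a j | j <- rev (iota 1 n)] = (convq a n)%:R / (convq a n.+1)%:R.
Proof.
move=> a0; elim: n => [|n IH]; first by rewrite /= mul0r.
have -> : iota 1 n.+1 = rcons (iota 1 n) n.+1 by rewrite -cats1 -[n.+1 in LHS]addn1 iotaD.
rewrite rev_rcons map_cons cf_cons IH convSS.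
rewrite natrD natrM; have q0 : (0 : R) < (convq a n.+1)%:R by rewrite ltr0n convq_gt0.
have a1 : (1 : R) <= (a n.+1)%:R by rewrite ler1n a0.
have q1 := ler0n R (convq a n).
field; rewrite !gt_eqF//; nra.
Qed.

(** Numerator (for 1, 0) or denominator (for 0, 1) of [a_1, ..., a_n, i]; it goes with D(n + 1,
    i). *)
Definition semiconv (c0 c1 : nat) (a : nat -> nat) (n i : nat) : nat :=
  (i * conv c0 c1 a n.+1 + conv c0 c1 a n)%N.

(** One formula for both branches of [D]: when i is the full quotient, the last term is the inverse
    of a tail and unfolds into the next quotient plus the next tail. *)
Lemma D_formula (R : realType) (a : nat -> nat) n i :
  (forall n, 0 < n -> 0 < a n)%N -> (0 < i <= a n.+1)%N ->
  D R a n.+1 i = (i%:R + (convq a n)%:R / (convq a n.+1)%:R)^-1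
               + ((a n.+1)%:R - i%:R + cftail R a n.+2)^-1.
Proof.
move=> a0 /andP[i0 ian]; rewrite /D; case: eqP => [->|/eqP ine].
  rewrite subrr add0r cf_revE// convSS; rewrite cftailS// invrK addrA; congr (_ + _ + _).
    have q0 : (0 : R) < (convq a n.+1)%:R by rewrite ltr0n convq_gt0.
    have a1 : (1 : R) <= (a n.+1)%:R by rewrite ler1n a0.
    have q1 := ler0n R (convq a n).
    rewrite natrD natrM; field; rewrite !gt_eqF//; nra.
  by rewrite /cftail; congr (cf_inf R _); apply/funext => k; congr a; lia.
have lt_ian : (i < a n.+1)%N by rewrite ltn_neqAle ine.
rewrite cf_cons cf_revE//; congr (_ + _).
rewrite cf_infS => [|[|k]]; [|by rewrite subn_gt0|exact: a0].
rewrite natrB//; congr (_ + cf_inf R _)^-1; apply/funext => k; congr a; lia.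
Qed.

Definition semierr (R : realType) (a : nat -> nat) (n i : nat) : R :=
  cferr R a n - i%:R * cferr R a n.+1.

Lemma semierrE (R : realType) (a : nat -> nat) n i : (forall n, 0 < n -> 0 < a n)%N ->
  (semiconv 1 0 a n i)%:R - cftail R a 1 * (semiconv 0 1 a n i)%:R = (-1) ^+ n * semierr
    R a n i.
Proof.
move=> a0; rewrite /semiconv /semierr !natrD !natrM.
rewrite [LHS](_ : _ = ((convp a n)%:R - cftail R a 1 * (convq a n)%:R) +
  i%:R * ((convp a n.+1)%:R - cftail R a 1 * (convq a n.+1)%:R)); last by ring.
by rewrite !cferrE// exprS; ring.
Qed.

Lemma semierr_gt0 (R : realType) (a : nat -> nat) n i : (forall n, 0 < n -> 0 < a n)%N ->
  (i <= a n.+1)%N -> 0 < semierr R a n i.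
Proof.
move=> a0 ia; rewrite /semierr (cferrSS R n)//.
have := cferr_gt0 R n.+2 a0; have := cferr_gt0 R n.+1 a0.
have : i%:R <= (a n.+1)%:R :> R by rewrite ler_nat.
by move: (cferr _ _ _) (cferr _ _ _) => d e *; nra.
Qed.

(** With q', q the denominators of index n, n + 1 and t the tail of index n + 2, adding the two
    fractions of [D_formula] gives the numerator q (a_{n+1} + t) + q'. By [conv_cferr] this is the
    inverse of the error of index n + 1. *)
Lemma D_semierr (R : realType) (a : nat -> nat) n i :
  (forall n, 0 < n -> 0 < a n)%N -> (0 < i <= a n.+1)%N ->
  D R a n.+1 i = ((semiconv 0 1 a n i)%:R * semierr R a n i)^-1.
Proof.
move=> a0 hi; rewrite D_formula//; case/andP: hi => i0 ia.
have := conv_cferr R n a0; rewrite /semierr /semiconv natrD natrM (cferrSS R n)//.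
have -> : cferr R a n.+2 = cftail R a n.+2 * cferr R a n.+1 by rewrite /= mulrC.
have /andP[t0 _] := cftail_itv R n.+1 a0.
have d0 := cferr_gt0 R n.+1 a0.
have q0 : (0 : R) < (convq a n.+1)%:R by rewrite ltr0n convq_gt0.
have q1 := ler0n R (convq a n).
have i1 : 1 <= i%:R :> R by rewrite ler1n.
have ia' : i%:R <= (a n.+1)%:R :> R by rewrite ler_nat.
move: d0 t0 q0 q1 ia' i1; move: (cferr R a n.+1) (cftail R a n.+2) => d t.
move: ((convq a n.+1)%:R : R) ((convq a n)%:R : R) ((a n.+1)%:R : R) (i%:R : R).
move=> q r A I d0 t0 q0 q1 IA I1 e.
have e0 : I * q + r != 0 by rewrite gt_eqF//; nra.
have e1 : A - I + t != 0 by rewrite gt_eqF//; lra.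
have e2 : d != 0 by rewrite gt_eqF.
have -> : (I * q + r) * (A * d + t * d - I * d) = (I * q + r) * (A - I + t) * d by ring.
rewrite -[RHS]mul1r -{1}e; field.
by rewrite e0 e1 e2 gt_eqF.
Qed.

(** * The matrices g(a_1, ..., a_n) and the convergents *)

Lemma Tmx_pow (R : realType) (z : int) : Tmx R ^ z = mx2 1 z%:~R 0 1.
Proof.
have T_nat n : Tmx R ^+ n = mx2 1 n%:R 0 1.
  elim: n => [|n IH]; first by rewrite expr0 -[1]/(1%:M) scalar_mx2.
  by rewrite exprS IH -mulmxE mx2M; congr mx2; rewrite ?mulr0 ?mul0r -?natr1; ring.
case: z => n; first exact: T_nat.
rewrite -[LHS]/((Tmx R ^+ n.+1)^-1) T_nat NegzE.
have e : mx2 1 n.+1%:R 0 1 * mx2 1 (- n.+1%:R) 0 1 = 1 :> 'M[R]_2.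
  by rewrite -mulmxE mx2M -[RHS]/(1%:M) scalar_mx2; congr mx2; ring.
have [u _] := mulmx1_unit e.
by rewrite -[RHS](mulKr u) e mulr1.
Qed.

Lemma gmx_rcons (R : realType) (s : seq nat) (b : nat) :
  gmx R (rcons s b) = mx2 1 (eps (size s).+1 * b%:Z)%:~R 0 1 *m Rmx R *m gmx R s.
Proof.
rewrite /gmx size_rcons.
have -> : iota 1 (size s).+1 = rcons (iota 1 (size s)) (size s).+1.
  by rewrite -cats1 -[(size s).+1 in LHS]addn1 iotaD.
rewrite rev_rcons big_cons nth_rcons ltnn eqxx Tmx_pow -!mulmxE; congr (_ *m _).
apply: eq_big_seq => k; rewrite mem_rev mem_iota => /andP[k0 ks].
by rewrite nth_rcons; case: ltnP => //; lia.
Qed.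

Lemma eps_sqr k : eps k * eps k = 1.
Proof. by rewrite /eps; case: odd. Qed.

Lemma epsS k : eps k.+1 = - eps k.
Proof. by rewrite /eps /=; case: odd. Qed.

(** Up to signs, g(a_1, ..., a_n) inverts the matrix whose columns are two consecutive convergents;
    the alternation of [eps] makes the terms in a_n cancel. *)
Lemma gmx_conv (R : realType) (a : nat -> nat) n :
  exists2 t : int, t * t = 1 &
    gmx R [seq a j | j <- iota 1 n] *m vec2 (convp a n.+1)%:R (convq a n.+1)%:R = vec2 0
      t%:~R /\
    gmx R [seq a j | j <- iota 1 n] *m vec2 (convp a n)%:R (convq a n)%:R = vec2 (eps
      n.+1 * t)%:~R 0.
Proof.
elim: n => [|n [t tt [IH1 IH2]]].
  by exists 1; rewrite // /gmx big_nil !mul1mx.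
have -> : iota 1 n.+1 = rcons (iota 1 n) n.+1.
  by rewrite -cats1 -[n.+1 in LHS]addn1 iotaD.
rewrite map_rcons gmx_rcons size_map size_iota.
have g1 : mx2 1 (eps n.+1 * (a n.+1)%:Z)%:~R 0 1 *m Rmx R *m gmx R [seq a j | j <- iota
  1 n] *m
    vec2 (convp a n.+1)%:R (convq a n.+1)%:R = vec2 (- t%:~R) 0.
  rewrite -mulmxA IH1 -mulmxA !mx2_vec2; congr vec2; ring.
exists (eps n.+1 * t); first by rewrite mulrACA eps_sqr tt.
split; last by rewrite g1 epsS mulrA mulNr eps_sqr mulN1r intrN.
have -> : vec2 (convp a n.+2)%:R (convq a n.+2)%:R =
    (a n.+1)%:R *: vec2 (convp a n.+1)%:R (convq a n.+1)%:R + vec2 (convp a n)%:R (convq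
      a n)%:R :> 'cV[R]_2.
  by rewrite vec2Z vec2D !convSS !natrD !natrM.
rewrite mulmxDr -scalemxAr g1 -mulmxA IH2 -mulmxA !mx2_vec2 vec2Z vec2D.
have e : (eps n.+1)%:~R * (eps n.+1)%:~R = 1 :> R by rewrite -intrM eps_sqr.
rewrite !intrM; congr vec2; last by ring.
rewrite [LHS](_ : _ = (a n.+1)%:R * t%:~R * ((eps n.+1)%:~R * (eps n.+1)%:~R - 1));
  last by ring.
by rewrite e subrr mulr0.
Qed.

Lemma gmx_unit (R : realType) (s : seq nat) : gmx R s \in unitmx.
Proof.
elim/last_ind: s => [|s b IH]; first by rewrite /gmx big_nil unitmx1.
rewrite gmx_rcons !unitmx_mul IH andbT !unitmxE !det_mx2.
by rewrite !mulr0 !mulr1 subr0 sub0r opprK unitr1.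
Qed.

(** This is the origin of the matrix in the statement: it makes the direction of the intermediate
    convergent horizontal, so that m measures the multiplicity of X in that direction. *)
Lemma Rmx_gmx_semiconv (R : realType) (a : nat -> nat) n i :
  exists2 s : R, s ^+ 2 = 1 &
  Rmx R *m gmx R (rcons [seq a j | j <- iota 1 n] i) *m
    vec2 (semiconv 1 0 a n i)%:R (semiconv 0 1 a n i)%:R = vec2 s 0.
Proof.
have [t tt [g1 g0]] := gmx_conv R a n.
rewrite gmx_rcons size_map size_iota.
have -> : vec2 (semiconv 1 0 a n i)%:R (semiconv 0 1 a n i)%:R =
    i%:R *: vec2 (convp a n.+1)%:R (convq a n.+1)%:R + vec2 (convp a n)%:R (convq a
      n)%:R :> 'cV[R]_2.
  by rewrite vec2Z vec2D !natrD !natrM.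
exists (- (eps n.+1 * t)%:~R).
  by rewrite sqrrN expr2 -intrM mulrACA eps_sqr tt.
rewrite -mulmxA -[X in _ *m X]mulmxA mulmxDr -scalemxAr g1 g0 vec2Z vec2D -mulmxA
  !mx2_vec2.
have e : (eps n.+1)%:~R * (eps n.+1)%:~R = 1 :> R by rewrite -intrM eps_sqr.
rewrite !intrM; congr vec2; first by ring.
rewrite [LHS](_ : _ = i%:R * t%:~R * ((eps n.+1)%:~R * (eps n.+1)%:~R - 1)); last by ring.
by rewrite e subrr mulr0.
Qed.

Lemma conv_det_int (a : nat -> nat) n :
  exists2 e : int, e * e = 1 &
    (convp a n)%:Z * (convq a n.+1)%:Z - (convq a n)%:Z * (convp a n.+1)%:Z = e.
Proof.
have := conv_det a n; case: odd => h; [exists (-1)|exists 1] => //; rewrite -!PoszM h;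
  lia.
Qed.

(* Write (x, y) = c w + d u with u, w the consecutive convergents whose heights
   surround y.  The small error forces |d| < 2; d = 0 contradicts primitivity,
   and d = -1 makes the errors of c w and - u add up. *)
Lemma small_err_semiconv (R : realType) (a : nat -> nat) (x y e f : int) :
  (forall n, 0 < n -> 0 < a n)%N -> e * x + f * y = 1 -> 1 < y ->
  y%:~R * `|x%:~R - cftail R a 1 * y%:~R| < 1 ->
  exists n i, [/\ (0 < i <= a n.+1)%N, x = semiconv 1 0 a n i, y = semiconv 0 1 a n i
    & y <= convq a n.+2].
Proof.
move=> a0 bez y1 lt1; set al := cftail R a 1 in lt1.
(* The least such index is n + 2, because the heights of index 0 and 1 are 0 and 1 while y > 1. *)
have exm : exists m, y <= convq a m.
  by exists `|y|%N.+1; have := convq_ge `|y|%N a0; lia.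
have := ex_minnP exm; case=> -[|[|n]] ley minm; [move: ley; rewrite /=; lia..|].
have lty : (convq a n.+1)%:Z < y.
  by rewrite ltNge; apply/negP => /minm; rewrite ltnn.
have [eps' ee det] := conv_det_int a n.
have q0 := convq_gt0 n a0.
(* Cramer's rule in the basis of the convergents of index n + 1 and n, whose determinant [eps'] is
   its own inverse. *)
pose d := eps' * (x * (convq a n.+1)%:Z - y * (convp a n.+1)%:Z).
pose c := eps' * ((convp a n)%:Z * y - (convq a n)%:Z * x).
have xE : x = c * (convp a n.+1)%:Z + d * (convp a n)%:Z.
  rewrite [RHS](_ : _ = (eps' * ((convp a n)%:Z * (convq a n.+1)%:Z - (convq a n)%:Z *
    (convp a n.+1)%:Z)) * x).
    by rewrite det ee mul1r.
  by rewrite /c /d; ring.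
have yE : y = c * (convq a n.+1)%:Z + d * (convq a n)%:Z.
  rewrite [RHS](_ : _ = (eps' * ((convp a n)%:Z * (convq a n.+1)%:Z - (convq a n)%:Z *
    (convp a n.+1)%:Z)) * y).
    by rewrite det ee mul1r.
  by rewrite /c /d; ring.
have dE : d = eps' * (x * (convq a n.+1)%:Z - y * (convp a n.+1)%:Z) by [].
clearbody c d.
have q0R : (0 : R) < (convq a n.+1)%:R by rewrite ltr0n.
have yR : (convq a n.+1)%:R < y%:~R :> R by rewrite pmulrn ltr_int.
have yR2 : y%:~R <= (convq a n.+2)%:R :> R by rewrite pmulrn ler_int.
have d1 := cferr_gt0 R n.+1 a0; have d0 := cferr_gt0 R n a0.
have d2 := cferr_gt0 R n.+2 a0.
have cc0 := conv_cferr R n a0; have cc1 := conv_cferr R n.+1 a0.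
have errE : x%:~R - al * y%:~R = (-1) ^+ n * (d%:~R * cferr R a n - c%:~R * cferr R a
  n.+1).
  rewrite {1}xE {1}yE !intrD !intrM -!pmulrn.
  have := cferrE R n a0; have := cferrE R n.+1 a0; rewrite -/al exprS => h1 h0.
  rewrite [LHS](_ : _ = c%:~R * ((convp a n.+1)%:R - al * (convq a n.+1)%:R) +
    d%:~R * ((convp a n)%:R - al * (convq a n)%:R)); last by ring.
  by rewrite h1 h0; ring.
(* In terms of errors, the determinant is a difference of two products: the first is less than 1
   because the height of index n + 1 is below y, the second at most 1 because y is at most the
   height of index n + 2. *)
have dle : `|d| < 2.
  rewrite -(ltr_int R) intr_norm.
  have -> : d%:~R = eps'%:~R * ((x%:~R - al * y%:~R) * (convq a n.+1)%:R
       - y%:~R * ((-1) ^+ n.+1 * cferr R a n.+1)) :> R.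
    rewrite -cferrE// dE -/al intrM intrB !intrM -!pmulrn; ring.
  have eps1 : `|eps'%:~R| = 1 :> R.
    by rewrite -intr_norm; have -> : `|eps'| = 1 by nia.
  rewrite normrM eps1 mul1r; apply: (le_lt_trans (ler_normB _ _)).
  move: (cferr R a n.+1) d1 cc1 => v v0 cc1.
  rewrite !normrM normrX normrN1 expr1n mul1r [`|v|]gtr0_norm//.
  rewrite [`|y%:~R|]gtr0_norm; last by lra.
  rewrite [`|(convq a n.+1)%:R|]gtr0_norm//.
  have h1 : `|x%:~R - al * y%:~R| * (convq a n.+1)%:R < 1.
    by apply: le_lt_trans lt1; rewrite mulrC ler_wpM2r// ltW.
  have h2 : y%:~R * v <= 1.
    have q2 := mulr_gt0 q0R d2.
    by apply: (@le_trans _ _ ((convq a n.+2)%:R * v)); [rewrite ler_wpM2r// ltW|lra].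
  by have := ltr_leD h1 h2; rewrite -[in X in X -> _](natrD _ 1 1).
have q01 := convq_le n a0.
have [d0'|[d1'|dN1']] : d = 0 \/ d = 1 \/ d = -1 by lia.
- move: xE yE; rewrite d0' !mul0r !addr0 => xE yE.
  have cu : c * (e * (convp a n.+1)%:Z + f * (convq a n.+1)%:Z) = 1.
    by rewrite -bez xE yE; ring.
  have : `|c|%N = 1%N.
    by apply/eqP; move/(congr1 absz)/eqP: cu; rewrite abszM muln_eq1 => /andP[].
  by nia.
- move: ley yE xE; rewrite d1' !mul1r convSS => ley yE xE.
  have [k ck] : exists k : nat, c = k by exists `|c|%N; nia.
  exists n, k; rewrite /semiconv; split; last by rewrite convSS.
  + by move: ley; rewrite yE ck; nia.
  + by rewrite xE ck PoszD PoszM.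
  + by rewrite yE ck PoszD PoszM.
- move: yE; rewrite dN1' mulN1r => yE.
  (* Let q, r be the heights and v, u the errors of index n + 1, n. Then y > q forces c >= 2, and y
     times its error is at least q (u + 2 v) >= q u + r v = 1. *)
  have c2 : 2 <= c by nia.
  have c2R : 2 <= c%:~R :> R by rewrite (ler_int R 2).
  exfalso; move: lt1; apply/negP; rewrite -leNgt errE dN1' normrM normrX normrN1 expr1n
    mul1r.
  rewrite [X in `|X|](_ : _ = - (cferr R a n + c%:~R * cferr R a n.+1)); last first.
    by rewrite intrN mulN1r opprD.
  rewrite normrN gtr0_norm; last by nra.
  rewrite -[X in X <= _]cc0 yE intrB intrM -!pmulrn.
  have q01R : (convq a n)%:R <= (convq a n.+1)%:R :> R by rewrite ler_nat.
  have qnR := ler0n R (convq a n).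
  move: (cferr R a n) (cferr R a n.+1) d1 d0 => u v v0 u0.
  move: ((convq a n.+1)%:R : R) ((convq a n)%:R : R) (c%:~R : R) q0R q01R qnR c2R => q r
    C q0' rq r0 C2.
  have h1 : q <= C * q - r by nra.
  have h2 : u + 2 * v <= u + C * v by nra.
  by apply: (@le_trans _ _ (q * (u + 2 * v))); [nra|rewrite ler_pM//; nra].
Qed.

(** * Multiplicities in the directions of the semiconvergents *)

(* The multiplicity of a primitive vector, when it is known to be at most 2. *)
Definition dmult (R : realType) (N : nat) (X : tsurf R N) (x y : nat) : R :=
  if `[< Hol X (vec2 x%:R y%:R) >] then 1 else 2.

Lemma dmult_sqr (R : realType) (N : nat) (X : tsurf R N) x y :
  1 <= dmult X x y ^+ 2 <= 4.
Proof. by rewrite /dmult; case: ifP => _; rewrite ?expr1n -?natrX !(ler_nat,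
  ler1n) ?lexx//; lra. Qed.

Lemma Hol_pair (R : realType) (N : nat) (X : tsurf R N) (x y x' y' : nat) :
  frame X = 1%:M -> (N < 3 * #|singular (hperm X) (vperm X)|)%N ->
  (x * y' = (y * x').+1 \/ y * x' = (x * y').+1)%N ->
  (Hol X (vec2 x%:R y%:R) \/ Hol X (vec2 (2 * x%:R) (2 * y%:R))) /\
  [\/ Hol X (vec2 x%:R y%:R), Hol X (vec2 x'%:R y'%:R) | Hol X (vec2 (x + x')%:R (y +
    y')%:R)].
Proof.
case: X => h v f /= -> hN det.
by have := @Hol_basis R N h v x y x' y' hN det; rewrite /= !natrM.
Qed.

Lemma semiconv_det (a : nat -> nat) n i :
  (semiconv 1 0 a n i * convq a n.+1 = (semiconv 0 1 a n i * convp a n.+1).+1 \/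
   semiconv 0 1 a n i * convp a n.+1 = (semiconv 1 0 a n i * convq a n.+1).+1)%N.
Proof. by have := conv_det a n; rewrite /semiconv; case: odd => h; [right|left]; nia. Qed.

Lemma hmult_semiconv (R : realType) (N : nat) (X : tsurf R N) (a : nat -> nat) n i :
  frame X = 1%:M -> (N < 3 * #|singular (hperm X) (vperm X)|)%N ->
  hmult (surf_act (Rmx R *m gmx R (rcons [seq a j | j <- iota 1 n] i)) X) =
  dmult X (semiconv 1 0 a n i) (semiconv 0 1 a n i).
Proof.
move=> f1 hN; have [s s1 Mv] := Rmx_gmx_semiconv R a n i.
have det := semiconv_det a n i.
have [h12 _] := Hol_pair f1 hN det.
have Mu : Rmx R *m gmx R (rcons [seq a j | j <- iota 1 n] i) \in unitmx.
  by rewrite unitmx_mul gmx_unit andbT unitmxE det_mx2 mulr0 mulr1 sub0r opprK unitr1.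
(* The convergent of index n + 1 supplies the Bezout coefficients, through the determinant. *)
have [c [d bez]] : exists c d : int,
    c%:~R * (semiconv 1 0 a n i)%:R + d%:~R * (semiconv 0 1 a n i)%:R = 1 :> R.
  case: det => /(congr1 (fun k => k%:R : R)); rewrite -natr1 !natrM => e;
    [exists (convq a n.+1), (- (convp a n.+1)%:Z)|exists (- (convq a n.+1)%:Z),
      (convp a n.+1)];
    rewrite intrN -!pmulrn; lra.
exact: (hmult_eq f1 Mu s1 Mv bez h12).
Qed.

Lemma semiconv_last c0 c1 a n : semiconv c0 c1 a n (a n.+1) = conv c0 c1 a n.+2.
Proof. by []. Qed.

Lemma semiconv1 c0 c1 a n : semiconv c0 c1 a n 1 = (conv c0 c1 a n.+1 + conv c0 c1 a n)%N.
Proof. by rewrite /semiconv mul1n. Qed.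

Lemma semierr_last (R : realType) (a : nat -> nat) n : (forall n, 0 < n -> 0 < a n)%N ->
  semierr R a n (a n.+1) = cferr R a n.+2.
Proof. by move=> a0; rewrite /semierr (cferrSS R n)// [_ + cferr _ _ _]addrC addrK. Qed.

(* When the directions [u] and [w] of two consecutive convergents both have
   multiplicity 2, that of [u + w] has multiplicity 1; if [t] is the product
   of the height and the error of [w], the two values at stake are at least
   [1 / (4 t)] and [4 t]. *)
Lemma exists_D_ge1 (R : realType) (N : nat) (X : tsurf R N) (a : nat -> nat) j :
  frame X = 1%:M -> (N < 3 * #|singular (hperm X) (vperm X)|)%N ->
  (forall n, 0 < n -> 0 < a n)%N ->
  exists n i, [/\ (j <= n)%N, (0 < i <= a n.+1)%N &
    1 <= D R a n.+1 i / dmult X (semiconv 1 0 a n i) (semiconv 0 1 a n i) ^+ 2].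
Proof.
move=> f1 hN a0.
have conv_case n : (j <= n)%N -> Hol X (vec2 (convp a n.+2)%:R (convq a n.+2)%:R) ->
    exists n i, [/\ (j <= n)%N, (0 < i <= a n.+1)%N &
      1 <= D R a n.+1 i / dmult X (semiconv 1 0 a n i) (semiconv 0 1 a n i) ^+ 2].
  move=> jn hol; have ian : (0 < a n.+1 <= a n.+1)%N by rewrite a0 /=.
  exists n, (a n.+1); split=> //; rewrite D_semierr// semierr_last// !semiconv_last.
  rewrite /dmult (asboolT hol) expr1n divr1.
  have q0 : (0 : R) < (convq a n.+2)%:R by rewrite ltr0n convq_gt0.
  have d0 := cferr_gt0 R n.+2 a0.
  rewrite invf_ge1; last exact: mulr_gt0.
  have := conv_cferr R n.+2 a0.
  have : (convq a n.+2)%:R <= (convq a n.+3)%:R :> R by rewrite ler_nat convq_le.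
  have d1 := cferr_gt0 R n.+3 a0.
  move: (cferr R a n.+2) (cferr R a n.+3) d0 d1 => u v u0 v0 le_q e.
  by nra.
have ian : (0 < a j.+2 <= a j.+2)%N by rewrite a0 /=.
have i1 : (0 < 1 <= a j.+3)%N by rewrite a0.
have det : (convp a j.+2 * convq a j.+3 = (convq a j.+2 * convp a j.+3).+1 \/
            convq a j.+2 * convp a j.+3 = (convp a j.+2 * convq a j.+3).+1)%N.
  by have := conv_det a j.+2; case: odd => h; [right|left].
have [_ [h|h|h]] := Hol_pair f1 hN det.
- exact: conv_case h.
- exact: conv_case h.
have q0 : (0 : R) < (convq a j.+2)%:R by rewrite ltr0n convq_gt0.
have q1 : (0 : R) < (convq a j.+3)%:R by rewrite ltr0n convq_gt0.
have d1 := cferr_gt0 R j.+3 a0.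
have dd := semierr_gt0 R a0 i1; rewrite /semierr mul1r in dd.
have cc := conv_cferr R j.+2 a0.
have [small|big] := lerP (4 * ((convq a j.+3)%:R * cferr R a j.+3)) 1.
  exists j.+1, (a j.+2); split=> //; rewrite D_semierr// semierr_last// !semiconv_last.
  have := dmult_sqr X (convp a j.+3) (convq a j.+3).
  move: (dmult _ _ _ ^+ 2) (cferr _ _ _) d1 small => m d d1 small /andP[m1 m4].
  have qd := mulr_gt0 q1 d1; have m0 : 0 < m by lra.
  rewrite -invfM invf_ge1; last exact: mulr_gt0.
  by apply: le_trans small; rewrite [leLHS]mulrC ler_wpM2r// ltW.
exists j.+2, 1%N; split=> //; first lia.
rewrite D_semierr// !semiconv1 /semierr mul1r.
rewrite /dmult asboolT; last by rewrite ![(conv _ _ _ j.+3 + _)%N]addnC.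
rewrite expr1n divr1 natrD.
move: dd cc big; move: (cferr R a j.+2) (cferr R a j.+3) d1 => u v v0 uv cc big.
move: cc big; move: ((convq a j.+3)%:R : R) ((convq a j.+2)%:R : R) q0 q1 => q r r0 q0
  cc big.
have x0 : 0 < (q + r) * (u - v) by rewrite mulr_gt0//; lra.
rewrite invf_ge1//.
(* The factors (q + r) v and q (u - v) have sum q u + r v = 1, so their product is at most 1/4. *)
have pr : ((q + r) * v) * (q * (u - v)) * 4 <= 1.
  have -> : q * (u - v) = 1 - (q + r) * v by rewrite -cc; ring.
  by have := sqr_ge0 (2 * ((q + r) * v) - 1); rewrite expr2; nra.
have pr' : (q + r) * (u - v) * (4 * (q * v)) <= 1.
  by rewrite [leLHS](_ : _ = ((q + r) * v) * (q * (u - v)) * 4)//; ring.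
by apply: le_trans pr'; rewrite ler_peMr// ltW.
Qed.

(** * The geodesic flow *)

(* The squared length of the period (x, y) after normalization to area 1 and
   flowing for the time t with S = e^(2t). *)
Definition flow_norm2 (R : realType) (N : nat) (al S x y : R) : R :=
  (S * (x - al * y) ^+ 2 + (al * x + y) ^+ 2 / S) / (N%:R * (1 + al ^+ 2)).

Lemma rot_atan (R : realType) (al : R) :
  Defs.rot (atan al) = (Num.sqrt (1 + al ^+ 2))^-1 *: mx2 1 (- al) al 1.
Proof.
have w0 : 0 < Num.sqrt (1 + al ^+ 2) by rewrite sqrtr_gt0 ltr_wpDr ?sqr_ge0.
have sinE : sin (atan al) = al / Num.sqrt (1 + al ^+ 2).
  have := atanK al; rewrite /tan cos_atan invrK => e.
  by rewrite -[X in X / _]e mulfK// gt_eqF.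
rewrite /Defs.rot cos_atan sinE; apply/matrixP => i j; rewrite !mxE.
by case: ifP => _; case: ifP => _; rewrite ?mulr1 ?mulrN// mulrC.
Qed.

Definition flow_mx (R : realType) (N : nat) (al t : R) : 'M[R]_2 :=
  geod t *m ((Num.sqrt N%:R)^-1%:M *m Defs.rot (atan al)).

Lemma flow_mx_unit (R : realType) (N : nat) (al t : R) : (0 < N)%N ->
  flow_mx N al t \in unitmx.
Proof.
move=> N0; rewrite !unitmx_mul !unitmxE det_scalar !det_mx2 mulr0 subr0 -expRD subrr
  expR0.
rewrite unitr1 mulNr opprK -!expr2 cos2Dsin2 unitr1 andbT /=.
by rewrite unitfE expf_neq0// invr_eq0 gt_eqF// sqrtr_gt0 ltr0n.
Qed.

Lemma flow_mx_surf (R : realType) (N : nat) (X : tsurf R N) (al t : R) : frame X = 1%:M ->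
  surf_act (geod t) (normalize (surf_act (Defs.rot (atan al)) X)) = surf_act (flow_mx N
    al t) X.
Proof.
case: X => h v f /= ->; rewrite /normalize /surf_act /area /=.
have -> : \det (Defs.rot (atan al) *m 1%:M) = 1 :> R.
  by rewrite mulmx1 det_mx2 mulNr opprK -!expr2 cos2Dsin2.
by rewrite mulr1 /flow_mx !mulmxA.
Qed.

Lemma enorm_flow_mx (R : realType) (N : nat) (al t x y : R) : (0 < N)%N ->
  enorm (flow_mx N al t *m vec2 x y) ^+ 2 = flow_norm2 N al (expR t ^+ 2) x y.
Proof.
move=> N0; rewrite /flow_mx rot_atan -!mulmxA -scalemxAl mx2_vec2 vec2Z scalar_mx2
  !mx2_vec2.
rewrite enorm_vec2 sqr_sqrtr ?addr_ge0 ?sqr_ge0//.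
rewrite !mul0r !addr0 !add0r !mul1r mulNr !exprMn expRN !exprVn.
have n0 : 0 < N%:R :> R by rewrite ltr0n.
have w0 : 0 < 1 + al ^+ 2 by rewrite ltr_wpDr ?sqr_ge0.
rewrite !sqr_sqrtr ?(ltW n0) ?(ltW w0)// /flow_norm2; field.
by rewrite !gt_eqF// expR_gt0.
Qed.

(** Crude but uniform over the nonzero integer vectors: the smallest stretching of the flow. It is
    used to keep the systole away from 0. *)
Lemma flow_norm2_ge1 (R : realType) (N : nat) (al S : R) (x y : int) : (0 < N)%N ->
  0 < S ->
  (x, y) != (0, 0) -> Num.min S S^-1 / N%:R <= flow_norm2 N al S x%:~R y%:~R.
Proof.
move=> N0 S0 xy0; have n0 : 0 < N%:R :> R by rewrite ltr0n.
have w0 : 0 < 1 + al ^+ 2 by rewrite ltr_wpDr ?sqr_ge0.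
set m := Num.min _ _.
have m0 : 0 < m by rewrite lt_min S0 invr_gt0.
have mS : m <= S by rewrite ge_min lexx.
have mV : m <= S^-1 by rewrite ge_min lexx orbT.
rewrite /flow_norm2 [N%:R * _]mulrC invfM mulrA ler_pM2r ?invr_gt0// ler_pdivlMr//.
have xy1 : 1 <= x%:~R ^+ 2 + y%:~R ^+ 2 :> R.
  rewrite -!rmorphXn -intrD (ler_int R 1).
  by move: xy0; rewrite xpair_eqE negb_and !expr2 => /orP[x0|y0]; nia.
apply: (@le_trans _ _ (m * ((x%:~R - al * y%:~R) ^+ 2 + (al * x%:~R + y%:~R) ^+ 2))).
  rewrite ler_pM2l// [leRHS](_ : _ = (1 + al ^+ 2) * (x%:~R ^+ 2 + y%:~R ^+ 2));
    last by ring.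
  by rewrite ler_peMr// ltW.
by rewrite mulrDr [leRHS]addrC [_ / S]mulrC addrC lerD// ler_wpM2r ?sqr_ge0.
Qed.

Lemma flow_norm2N (R : realType) (N : nat) (al S x y : R) : flow_norm2 N al S (- x) (-
  y) = flow_norm2 N al S x y.
Proof. by rewrite /flow_norm2 mulrN -opprB opprK mulrN -opprD; congr (_ / _); ring. Qed.

Lemma flow_norm2M (R : realType) (N : nat) (al S g x y : R) :
  flow_norm2 N al S (g * x) (g * y) = g ^+ 2 * flow_norm2 N al S x y.
Proof. by rewrite /flow_norm2 [RHS]mulrA; congr (_ / _); ring. Qed.

Lemma flow_norm2_ge_err (R : realType) (N : nat) (al S x y : R) : (0 < N)%N -> 0 < S ->
  S * (x - al * y) ^+ 2 / (N%:R * (1 + al ^+ 2)) <= flow_norm2 N al S x y.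
Proof.
move=> N0 S0; have n0 : 0 < N%:R :> R by rewrite ltr0n.
have w0 : 0 < 1 + al ^+ 2 by rewrite ltr_wpDr ?sqr_ge0.
by rewrite /flow_norm2 ler_pM2r ?invr_gt0 ?mulr_gt0// lerDl divr_ge0 ?sqr_ge0 ?ltW.
Qed.

(* In the rotated frame the product of the coordinates of (x, y) is
   |x - al y| |al x + y| / (1 + al^2), hence close to |x - al y| y. *)
Lemma rot_product (R : realType) (al x y : R) : 0 < al < 1 -> `|x - al * y| <= 1 ->
  1 <= y ->
  y - 1 <= `|al * x + y| / (1 + al ^+ 2) <= y + 1.
Proof.
move=> /andP[al0 al1]; rewrite ler_norml => /andP[e1 e2] y1.
have w0 : 0 < 1 + al ^+ 2 by rewrite ltr_wpDr ?sqr_ge0.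
have -> : al * x + y = (1 + al ^+ 2) * y + al * (x - al * y) by ring.
move: (x - al * y) e1 e2 => e e1 e2.
have al2 : 0 <= al ^+ 2 by rewrite sqr_ge0.
rewrite ger0_norm; last by nra.
by rewrite ler_pdivlMr// ler_pdivrMr//; apply/andP; split; nra.
Qed.

(** S A^2 + B^2 / S >= 2 A B for the two rotated coordinates; the loss from y to y - 1 is the cost
    of the rotation. *)
Lemma flow_norm2_ge_product (R : realType) (N : nat) (al S x y : R) : (0 < N)%N ->
  0 < S ->
  0 < al < 1 -> `|x - al * y| <= 1 -> 1 <= y ->
  2 * `|x - al * y| * (y - 1) / N%:R <= flow_norm2 N al S x y.
Proof.
move=> N0 S0 al01 e1 y1; have n0 : 0 < N%:R :> R by rewrite ltr0n.
have w0 : 0 < 1 + al ^+ 2 by rewrite ltr_wpDr ?sqr_ge0.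
have /andP[p1 _] := rot_product al01 e1 y1.
apply: (@le_trans _ _ (2 * `|x - al * y| * (`|al * x + y| / (1 + al ^+ 2)) / N%:R)).
  by rewrite ler_pM2r ?invr_gt0// ler_wpM2l// mulr_ge0.
rewrite mulrA -mulrA -invfM [_ * N%:R]mulrC ler_pM2r ?invr_gt0 ?mulr_gt0//.
rewrite -(real_normK (num_real (x - _))) -(real_normK (num_real (al * x + y))).
move: (`|x - al * y| : R) (`|al * x + y| : R) => A B.
have := sqr_ge0 (S * A - B) => h.
have -> : S * A ^+ 2 + B ^+ 2 / S = (S * A - B) ^+ 2 / S + 2 * A * B.
  by field; rewrite gt_eqF.
by rewrite lerDr divr_ge0// ltW.
Qed.

(** At S = B / A the two coordinates have equal length after the flow, the equality case of the
    previous bound. *)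
Lemma flow_norm2_balanced (R : realType) (N : nat) (al x y : R) : (0 < N)%N ->
  0 < al < 1 -> `|x - al * y| <= 1 -> 1 < y -> x - al * y != 0 ->
  flow_norm2 N al (`|al * x + y| / `|x - al * y|) x y <= 2 * `|x - al * y| * (y + 1) /
    N%:R.
Proof.
move=> N0 al01 e1 y1 e0; have n0 : 0 < N%:R :> R by rewrite ltr0n.
have w0 : 0 < 1 + al ^+ 2 by rewrite ltr_wpDr ?sqr_ge0.
have /andP[p1 p2] := rot_product al01 e1 (ltW y1).
apply: (@le_trans _ _ (2 * `|x - al * y| * (`|al * x + y| / (1 + al ^+ 2)) / N%:R));
  last first.
  by rewrite ler_pM2r ?invr_gt0// ler_wpM2l// mulr_ge0.
have A0 : 0 < `|x - al * y| by rewrite normr_gt0.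
have B0 : 0 < `|al * x + y|.
  have : 0 < `|al * x + y| / (1 + al ^+ 2) by apply: lt_le_trans p1; lra.
  by rewrite pmulr_lgt0 ?invr_gt0.
rewrite mulrA -[leRHS]mulrA -invfM [_ * N%:R]mulrC /flow_norm2 ler_pM2r ?invr_gt0
  ?mulr_gt0//.
rewrite -(real_normK (num_real (x - _))) -(real_normK (num_real (al * x + y))).
move: (`|x - al * y| : R) (`|al * x + y| : R) A0 B0 => A B A0 B0.
by rewrite le_eqVlt; apply/orP; left; apply/eqP; field; rewrite !gt_eqF.
Qed.

(** * Vectors of bounded height and primitive vectors *)

Lemma irrational_err (R : realType) (al : R) (x y : int) : irrational al ->
  (x, y) != (0, 0) -> x%:~R - al * y%:~R != 0.
Proof.
move=> irr xy0; apply/eqP => e; apply: irr.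
have [y0|y0] := eqVneq y 0.
  move: e xy0; rewrite y0 mulr0 subr0 xpair_eqE eqxx andbT => /eqP.
  by rewrite intr_eq0 => ->.
have alE : al = x%:~R / y%:~R.
  by apply: (mulIf (_ : y%:~R != 0)); rewrite ?intr_eq0// divfK ?intr_eq0//; lra.
apply/rationalP; case: y y0 alE {e xy0} => n n0 ->; first by exists x, n.
by exists (- x), n.+1; rewrite NegzE !intrN invrN mulrN mulNr.
Qed.

(** Induction on the height bound: among the infinitely many x for a given y, only the two integers
    around al y compete. The bound c <= 1 later provides the hypothesis of [rot_product]. *)
Lemma err_lower_bound (R : realType) (al : R) (Y0 : nat) : irrational al ->
  exists2 c, 0 < c <= 1 & forall (x : int) (y : nat), (y <= Y0)%N ->
    (x, y%:Z) != (0, 0) ->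
    c <= `|x%:~R - al * y%:R|.
Proof.
move=> irr; elim: Y0 => [|Y0 [c /andP[c0 c1] IH]].
  exists 1; first by rewrite ltr01 lexx.
  move=> x y; rewrite leqn0 => /eqP ->; rewrite xpair_eqE andbT mulr0 subr0.
  exact: intr_norm_ge1.
pose f := Num.floor (al * Y0.+1%:R).
pose d := Num.min `|f%:~R - al * Y0.+1%:R| `|(f + 1)%:~R - al * Y0.+1%:R|.
have Y0n x : x%:~R - al * Y0.+1%:R != 0.
  by apply: (@irrational_err _ _ x Y0.+1); rewrite // xpair_eqE andbF.
exists (Num.min c d).
  by rewrite lt_min c0 ge_min c1 /d lt_min !normr_gt0 !Y0n.
move=> x y; rewrite leq_eqVlt => /orP[/eqP ->|le_y] xy0; last first.
  by apply: le_trans (IH x y le_y xy0); rewrite ge_min lexx.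
apply: (@le_trans _ _ d); first by rewrite ge_min lexx orbT.
have /andP[f1 f2] := floor_itv (al * Y0.+1%:R); rewrite -/f in f1 f2.
have [xf|fx] := lerP x f.
  apply: (@le_trans _ _ `|f%:~R - al * Y0.+1%:R|); first by rewrite ge_min lexx.
  have xfR : x%:~R <= f%:~R :> R by rewrite ler_int.
  by rewrite !ler0_norm; lra.
apply: (@le_trans _ _ `|(f + 1)%:~R - al * Y0.+1%:R|); first by rewrite ge_min lexx orbT.
have fxR : (f + 1)%:~R <= x%:~R :> R by rewrite ler_int; lia.
by rewrite !ger0_norm; lra.
Qed.

Lemma primitive_decomp (x y : int) : (x, y) != (0, 0) -> 0 <= y ->
  exists (g p q e f : int), [/\ 0 < g, x = g * p, y = g * q, 0 <= q & e * p + f * q = 1].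
Proof.
move=> xy0 y0; pose g := gcdz x y.
have g0 : 0 < g.
  by rewrite lt_neqAle eq_sym gcdz_eq0 -xpair_eqE xy0 /=.
have [e [f bez]] := Bezoutz x y.
have /dvdzP[p xE] := dvdz_gcdl x y; have /dvdzP[q yE] := dvdz_gcdr x y.
rewrite -/g in xE yE bez.
exists g, p, q, e, f; split=> //; [by rewrite mulrC|by rewrite mulrC|nia|].
by apply: (@mulIf _ g); [rewrite gt_eqF|rewrite mul1r -[RHS]bez xE yE; ring].
Qed.

(** * Bounds for the systole *)

Lemma Sys_le (R : realType) (N : nat) (S : tsurf R N) b : 0 < b -> Hol S !=set0 ->
  (forall u, Hol S u -> b <= enorm u ^+ 2) -> 2 / Sys S ^+ 2 <= 2 / b.
Proof.
move=> b0 [u0 hu0] lb.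
have le_Sys : Num.sqrt b <= Sys S.
  apply: lb_le_inf; first by exists (enorm u0), u0.
  move=> _ [u uS <-]; rewrite -(ger0_norm (enorm_ge0 u)) -sqrtr_sqr ler_sqrt ?sqr_ge0//.
  exact: lb.
have s0 : 0 < Num.sqrt b by rewrite sqrtr_gt0.
have S0 := lt_le_trans s0 le_Sys.
rewrite ler_pM2l// lef_pV2 ?posrE ?exprn_gt0//.
by rewrite -(sqr_sqrtr (ltW b0)) lerXn2r ?nnegrE ?(ltW s0) ?(ltW S0).
Qed.

(** The uniform bound [b] makes the systole positive, so that its inverse is not the default value
    0. *)
Lemma Sys_ge (R : realType) (N : nat) (S : tsurf R N) b u : 0 < b -> Hol S u ->
  (forall u, Hol S u -> b <= enorm u ^+ 2) -> 2 / enorm u ^+ 2 <= 2 / Sys S ^+ 2.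
Proof.
move=> b0 hu lb.
have lbS : lbound (@enorm R @` Hol S) (Num.sqrt b).
  move=> _ [v vS <-]; rewrite -(ger0_norm (enorm_ge0 v)) -sqrtr_sqr ler_sqrt ?sqr_ge0//.
  exact: lb.
have s0 : 0 < Num.sqrt b by rewrite sqrtr_gt0.
have S0 : 0 < Sys S by apply: lt_le_trans s0 _; apply: lb_le_inf => //;
  exists (enorm u), u.
have Su : Sys S <= enorm u by apply: ge_inf; [exists (Num.sqrt b)|exists u].
have u0 := lt_le_trans S0 Su.
rewrite ler_pM2l// lef_pV2 ?posrE ?exprn_gt0//.
by rewrite lerXn2r ?nnegrE ?(ltW S0) ?(ltW u0).
Qed.

Lemma flow_norm2_ge0 (R : realType) (N : nat) (al S x y : R) : 0 <= S ->
  0 <= flow_norm2 N al S x y.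
Proof.
move=> S0; rewrite /flow_norm2 divr_ge0//; last by rewrite mulr_ge0// addr_ge0// sqr_ge0.
by apply: addr_ge0; [exact: mulr_ge0 (sqr_ge0 _)|exact: divr_ge0 (sqr_ge0 _) S0].
Qed.

Lemma semierr_norm (R : realType) (a : nat -> nat) n i : (forall n, 0 < n -> 0 < a n)%N ->
  (i <= a n.+1)%N ->
  `|(semiconv 1 0 a n i)%:R - cftail R a 1 * (semiconv 0 1 a n i)%:R| = semierr R a n i.
Proof.
move=> a0 ia; rewrite semierrE// normrM normrX normrN1 expr1n mul1r gtr0_norm//.
exact: semierr_gt0.
Qed.

Lemma Hol_neq0 (R : realType) (N : nat) (X : tsurf R N) (x y : int) :
  Hol X (vec2 x%:~R y%:~R) -> (x, y) != (0, 0).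
Proof.
by case=> xy0 _; apply/eqP => -[x0 y0]; apply: xy0; rewrite x0 y0; exact/vec2_eq0.
Qed.

Lemma Hol_flow_norm2 (R : realType) (N : nat) (X : tsurf R N) (al t b : R) :
  frame X = 1%:M -> (0 < N)%N ->
  (forall x y : int, 0 <= y -> Hol X (vec2 x%:~R y%:~R) ->
    b <= flow_norm2 N al (expR t ^+ 2) x%:~R y%:~R) ->
  forall u, Hol (surf_act (flow_mx N al t) X) u -> b <= enorm u ^+ 2.
Proof.
move=> f1 N0 lb u; rewrite Hol_actE ?flow_mx_unit// => -[w wX <-].
have [x [y wE]] := Hol_ivec f1 wX; rewrite wE in wX *.
rewrite enorm_flow_mx//; have [y0|/ltW y0] := lerP 0 y; first exact: lb.
by rewrite -flow_norm2N -!intrN; apply: lb; [lia|rewrite !intrN -vec2N; exact: Hol_opp].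
Qed.

Lemma Hol_nonempty (R : realType) (N : nat) (X : tsurf R N) (al t : R) :
  frame X = 1%:M -> (0 < N)%N -> (N < 3 * #|singular (hperm X) (vperm X)|)%N ->
  Hol (surf_act (flow_mx N al t) X) !=set0.
Proof.
move=> f1 N0 hN.
have [h12 _] := @Hol_pair R N X 1 0 0 1 f1 hN (or_introl erefl).
have [u uX] : Hol X !=set0 by case: h12 => h;
  [exists (vec2 1 0)|exists (vec2 (2 * 1) (2 * 0))].
by exists (flow_mx N al t *m u); rewrite Hol_actE ?flow_mx_unit//; exists u.
Qed.

Lemma Sys_upper (R : realType) (N : nat) (X : tsurf R N) (a : nat -> nat) (B B' : R) n0 :
  frame X = 1%:M -> (0 < N)%N -> (N < 3 * #|singular (hperm X) (vperm X)|)%N ->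
  (forall n, 0 < n -> 0 < a n)%N -> irrational (cftail R a 1) -> 1 <= B -> B < B' ->
  (forall n i, (n0 <= n)%N -> (0 < i <= a n.+1)%N ->
    D R a n.+1 i / dmult X (semiconv 1 0 a n i) (semiconv 0 1 a n i) ^+ 2 <= B) ->
  exists T, forall t, T < t ->
    2 / Sys (surf_act (flow_mx N (cftail R a 1) t) X) ^+ 2 <= N%:R * B'.
Proof.
move=> f1 N0 hN a0 irr B1 BB' DB.
have al01 := cftail_itv R 0 a0; set al := cftail R a 1 in irr al01 *.
have n0R : 0 < N%:R :> R by rewrite ltr0n.
have w0 : 0 < 1 + al ^+ 2 by rewrite ltr_wpDr ?sqr_ge0.
have B'0 : 0 < B' by lra.
have dB : 0 < B' - B by lra.
(* Beyond height Y0 the first condition gives B q <= B' (q - 1), and the second forces an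
   intermediate convergent to have index at least n0. *)
have [Y0 Y0B Y0q] : exists2 Y0 : nat, B' / (B' - B) < Y0%:R & (convq a n0.+3 <= Y0)%N.
  exists (Num.Def.archi_bound (B' / (B' - B)) + convq a n0.+3)%N; last exact: leq_addl.
  apply: (lt_le_trans (archi_boundP _)); first by rewrite divr_ge0 ?ltW.
  by rewrite ler_nat leq_addr.
have [c /andP[c0 c1] err_c] := err_lower_bound Y0 irr.
(* Once e^(2t) >= K, any vector of error at least c has been stretched beyond the required
   length. *)
pose K := 2 * (1 + al ^+ 2) / (B' * c ^+ 2).
have c20 : 0 < c ^+ 2 by rewrite exprn_gt0.
have K0 : 0 < K by rewrite divr_gt0 ?mulr_gt0.
exists K => t Kt.
have S0 : 0 < expR t ^+ 2 by rewrite exprn_gt0 ?expR_gt0.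
have KS : K <= expR t ^+ 2 by have := expR_ge1Dx t; nra.
have b0 : 0 < 2 / (N%:R * B') by rewrite divr_gt0 ?mulr_gt0.
have -> : N%:R * B' = 2 / (2 / (N%:R * B')) by rewrite invf_div mulrCA mulfV ?mulr1
  ?pnatr_eq0.
apply: Sys_le => //; first exact: Hol_nonempty.
apply: Hol_flow_norm2 => // x y y0 hxy; move: (expR t ^+ 2) S0 KS => S S0 KS.
have [g [p [q [e [f [g0 xE yE q0 bez]]]]]] := primitive_decomp (Hol_neq0 hxy) y0.
have g1 : 1 <= g%:~R :> R by rewrite (ler_int R 1).
have g2 : 1 <= g%:~R ^+ 2 :> R by rewrite exprn_ege1.
rewrite xE yE !intrM flow_norm2M.
have pq0 : (p, q) != (0, 0).
  by apply/eqP => -[p0 q00]; move: bez; rewrite p0 q00 !mulr0.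
have [ec|ec] := lerP c `|p%:~R - al * q%:~R|.
  apply: (@le_trans _ _ (flow_norm2 N al S p%:~R q%:~R)); last first.
    by rewrite ler_peMl// flow_norm2_ge0// ltW.
  apply: le_trans (flow_norm2_ge_err _ _ _ N0 S0).
  rewrite -(real_normK (num_real (_ - _))) ler_pdivlMr ?mulr_gt0//.
  have -> : 2 / (N%:R * B') * (N%:R * (1 + al ^+ 2)) = K * c ^+ 2.
    by rewrite /K; field; rewrite !gt_eqF.
  apply: ler_pM => //; [exact: ltW|exact: ltW|].
  by rewrite lerXn2r ?nnegrE ?(ltW c0).
have Yq : (Y0 < `|q|)%N.
  rewrite ltnNge; apply/negP => qY; move: ec; apply/negP; rewrite -leNgt.
  rewrite -[q]gez0_abs//.
  by apply: err_c => //; rewrite gez0_abs.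
have q1 : 1 < q.
  have c0' := leq_ltn_trans (leq_trans (convq_gt0 n0.+2 a0) Y0q) Yq.
  by rewrite -[q]gez0_abs// ltz_nat.
have q1R : 1 <= q%:~R :> R by rewrite (ler_int R 1) ltW.
have Bq : B * q%:~R <= B' * (q%:~R - 1).
  have : B' / (B' - B) <= q%:~R.
    rewrite ltW// (lt_le_trans Y0B)// -[q]gez0_abs// pmulrn ler_int lez_nat.
    exact: ltnW.
  by rewrite ler_pdivrMr//; lra.
have h := flow_norm2_ge_product N0 S0 al01 (ltW (lt_le_trans ec c1)) q1R.
apply: (@le_trans _ _ (g%:~R ^+ 2 * (2 * `|p%:~R - al * q%:~R| * (q%:~R - 1) / N%:R)));
  last first.
  by rewrite ler_wpM2l// sqr_ge0.
set E := `|p%:~R - _| in ec h *.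
have E0 : 0 <= E by exact: normr_ge0.
(* If q E >= 1, this is [1 <= B]. Otherwise (p, q) is an intermediate convergent, and the hypothesis
   on [D] applies. *)
have main : 1 <= B * (g%:~R ^+ 2 * (q%:~R * E)).
  have [qE|qE] := lerP 1 (q%:~R * E).
    by rewrite mulr_ege1// mulr_ege1.
  have [n [i [ia pE qE' q_le]]] := small_err_semiconv a0 bez q1 qE.
  have n0n : (n0 <= n)%N.
    rewrite leqNgt; apply/negP => nn0; move: q_le; apply/negP; rewrite -ltNge.
    rewrite -[q]gez0_abs// ltz_nat; apply: leq_ltn_trans Yq; apply: leq_trans Y0q.
    by apply: convq_homo => //; rewrite !ltnS; exact: leqW (ltnW nn0).
  have := DB n i n0n ia; rewrite D_semierr//.
  have /andP[i0 ia'] := ia.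
  have EE : E = semierr R a n i by rewrite -semierr_norm// /E pE qE' -!pmulrn.
  have qR : q%:~R = (semiconv 0 1 a n i)%:R :> R by rewrite qE' -pmulrn.
  rewrite -EE -qR.
  have Egt0 : 0 < E by rewrite EE semierr_gt0.
  (* g (p, q) is a period: either g = 1 and the multiplicity is 1, or g >= 2. *)
  have mg : dmult X (semiconv 1 0 a n i) (semiconv 0 1 a n i) <= g%:~R.
    rewrite /dmult; case: asboolP => // nH.
    have [g1'|g1'] := eqVneq g 1; last by rewrite (ler_int R 2); clear -g0 g1'; lia.
    by case: nH; move: hxy; rewrite xE yE g1' !mul1r pE qE' -!pmulrn.
  have m1 : 1 <= dmult X (semiconv 1 0 a n i) (semiconv 0 1 a n i).
    by rewrite /dmult; case: ifP => _ //; rewrite ler1n.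
  move: (dmult _ _ _) m1 mg => m m1 mg.
  have m0 : 0 < m by lra.
  have qE0 : 0 < q%:~R * E by rewrite mulr_gt0//; lra.
  have m20 : 0 < m ^+ 2 by rewrite exprn_gt0.
  have qm0 := mulr_gt0 qE0 m20.
  rewrite -invfM -[X in X <= _]mul1r ler_pdivrMr// => hB.
  apply: (le_trans hB); rewrite ler_wpM2l//; first by lra.
  by rewrite mulrC ler_wpM2r// ?(ltW qE0)// lerXn2r ?nnegrE ?(ltW m0)//; lra.
rewrite ler_pdivrMr ?mulr_gt0//.
have -> : g%:~R ^+ 2 * (2 * E * (q%:~R - 1) / N%:R) * (N%:R * B') =
    2 * (g%:~R ^+ 2 * E * (B' * (q%:~R - 1))) by field; rewrite gt_eqF.
have : g%:~R ^+ 2 * E * (B * q%:~R) <= g%:~R ^+ 2 * E * (B' * (q%:~R - 1)).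
  by rewrite ler_wpM2l// mulr_ge0// sqr_ge0.
by lra.
Qed.

Lemma Sys_lower (R : realType) (N : nat) (X : tsurf R N) (a : nat ->
  nat) (b b2 T : R) n i :
  frame X = 1%:M -> (0 < N)%N -> (N < 3 * #|singular (hperm X) (vperm X)|)%N ->
  (forall n, 0 < n -> 0 < a n)%N -> 0 < b -> b < b2 -> (0 < i <= a n.+1)%N ->
  b2 < D R a n.+1 i / dmult X (semiconv 1 0 a n i) (semiconv 0 1 a n i) ^+ 2 ->
  b / (b2 - b) <= (convq a n.+1)%:R -> expR T ^+ 2 + 1 < (convq a n.+1)%:R ->
  exists2 t, T < t & N%:R * b <= 2 / Sys (surf_act (flow_mx N (cftail R a 1) t) X) ^+ 2.
Proof.
move=> f1 N0 hN a0 b0 bb2 ia; rewrite D_semierr//; have /andP[i0 ia'] := ia.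
have al01 := cftail_itv R 0 a0; have := semierr_norm R a0 ia'.
set al := cftail R a 1 in al01 *.
have Egt0 := semierr_gt0 R a0 ia'.
have ErrE := semierrE R n i a0; rewrite -/al in ErrE.
have le_y : (convq a n.+1 <= semiconv 0 1 a n i)%N by rewrite /semiconv; nia.
have le_yR : (convq a n.+1)%:R <= (semiconv 0 1 a n i)%:R :> R by rewrite ler_nat.
have [h12 _] := Hol_pair f1 hN (semiconv_det a n i).
have Ele1 : semierr R a n i <= 1.
  have := conv_cferr R n a0; rewrite /semierr.
  have : 1 <= (convq a n.+1)%:R :> R by rewrite ler1n convq_gt0.
  have := cferr_gt0 R n a0; have := cferr_gt0 R n.+1 a0.
  have := ler0n R (convq a n); have := ler0n R i.
  by move: (cferr R a n) (cferr R a n.+1) => u v *; nra.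
set x := (semiconv 1 0 a n i)%:R in h12 ErrE *.
set y := (semiconv 0 1 a n i)%:R in h12 le_yR ErrE *.
move=> absE; set E := semierr R a n i in Egt0 ErrE Ele1 absE *.
move=> Db2 large1 large2.
have n0R : 0 < N%:R :> R by rewrite ltr0n.
have e1 : `|x - al * y| <= 1 by rewrite absE.
have e0 : x - al * y != 0 by rewrite -normr_gt0 absE.
have y1 : 1 < y by have := sqr_ge0 (expR T); lra.
pose S := `|al * x + y| / `|x - al * y|.
have /andP[p1 _] := rot_product al01 e1 (ltW y1).
have w1 : 1 <= 1 + al ^+ 2 by rewrite lerDl sqr_ge0.
(* The balancing time grows with the height, since the error is at most 1; this is how t > T is
   obtained. *)
have Sy : y - 1 <= S.
  apply: (le_trans p1); rewrite /S ler_wpM2l// absE lef_pV2 ?posrE//; lra.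
have ST : expR T ^+ 2 < S by lra.
have S0 : 0 < S by apply: le_lt_trans ST; rewrite sqr_ge0.
pose t := ln S / 2.
have expt : expR t ^+ 2 = S.
  by rewrite expr2 -expRD /t -splitr lnK// posrE.
exists t.
  rewrite -ltr_expR -(ltr_pXn2r (n := 2))// ?nnegrE ?expR_ge0//.
  by rewrite expt.
set m := dmult _ _ _ in Db2 *.
have m1 : 1 <= m by rewrite /m /dmult; case: ifP => _ //; rewrite ler1n.
have mHol : Hol X (vec2 (m * x) (m * y)).
  by rewrite /m /dmult; case: asboolP => h; [rewrite !mul1r|case: h12].
have hu : Hol (surf_act (flow_mx N al t) X) (flow_mx N al t *m vec2 (m * x) (m * y)).
  by rewrite Hol_actE ?flow_mx_unit//; exists (vec2 (m * x) (m * y)).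
have lbt u : Hol (surf_act (flow_mx N al t) X) u -> Num.min S S^-1 / N%:R <= enorm u ^+ 2.
  apply: Hol_flow_norm2 => // x' y' _ hx'y'; rewrite expt.
  by apply: flow_norm2_ge1 => //; exact: Hol_neq0 hx'y'.
have min0 : 0 < Num.min S S^-1 / N%:R by rewrite divr_gt0// lt_min S0 invr_gt0.
apply: le_trans (Sys_ge min0 hu lbt).
rewrite enorm_flow_mx// flow_norm2M expt.
have tle := flow_norm2_balanced N0 al01 e1 y1 e0; rewrite -/S absE in tle.
have tge := flow_norm2_ge_product N0 S0 al01 e1 (ltW y1); rewrite absE in tge.
have t0 : 0 < flow_norm2 N al S x y.
  by apply: lt_le_trans tge; rewrite divr_gt0// !mulr_gt0//; lra.
have m20 : 0 < m ^+ 2 by rewrite exprn_gt0//; lra.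
have mt0 := mulr_gt0 m20 t0; have nb0 := mulr_gt0 n0R b0.
rewrite ler_pdivlMr//.
apply: (@le_trans _ _ (N%:R * b * (m ^+ 2 * (2 * E * (y + 1) / N%:R)))).
  by rewrite (ler_pM2l nb0) (ler_pM2l m20).
have -> : N%:R * b * (m ^+ 2 * (2 * E * (y + 1) / N%:R)) = 2 * (m ^+ 2 * E * (b * (y +
  1))).
  by field; rewrite gt_eqF.
(* The margin between b and b2 absorbs the y + 1 due to the rotation. *)
have by' : b * (y + 1) <= b2 * y.
  have : b / (b2 - b) <= y by apply: le_trans le_yR.
  by rewrite ler_pdivrMr ?subr_gt0//; lra.
have yE0 : 0 < y * E by rewrite mulr_gt0//; lra.
have ym0 := mulr_gt0 yE0 m20.
move: Db2; rewrite -invfM -[X in _ < X]mul1r ltr_pdivlMr// => Db2.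
have : m ^+ 2 * E * (b * (y + 1)) <= m ^+ 2 * E * (b2 * y).
  by rewrite ler_wpM2l// mulr_ge0 ?ltW.
by lra.
Qed.

(** * Limits superior *)

Lemma limf_esup_le (R : realType) (T : choiceType) (X : filteredType T) (f : X -> \bar R)
    (F : set (set X)) (V : set X) (M : \bar R) :
  F V -> (forall x, V x -> f x <= M)%E -> (limf_esup f F <= M)%E.
Proof.
move=> FV le_M; apply: (@le_trans _ _ (ereal_sup (f @` V))).
  by apply: ereal_inf_lbound; exists V.
by apply: ge_ereal_sup => _ [x Vx <-]; exact: le_M.
Qed.

Lemma limf_esup_ge (R : realType) (T : choiceType) (X : filteredType T) (f : X -> \bar R)
    (F : set (set X)) (M : \bar R) :
  (forall V, F V -> exists2 x, V x & M <= f x)%E -> (M <= limf_esup f F)%E.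
Proof.
move=> ge_M; apply: le_ereal_inf_tmp => _ [V /ge_M[x Vx Mx] <-].
by apply: le_trans Mx _; apply: ereal_sup_ubound; exists x.
Qed.

Lemma limf_esup_lt (R : realType) (T : choiceType) (X : filteredType T) (f : X -> \bar R)
    (F : set (set X)) (M : \bar R) :
  (limf_esup f F < M)%E -> exists2 V, F V & forall x, V x -> (f x <= M)%E.
Proof.
move=> /ereal_inf_lt[_ [V FV <-] lt_M]; exists V => // x Vx.
by apply: le_trans (ltW lt_M); apply: ereal_sup_ubound; exists x.
Qed.

Lemma limf_esup_gt (R : realType) (T : choiceType) (X : filteredType T) (f : X -> \bar R)
    (F : set (set X)) (M : \bar R) :
  (M < limf_esup f F)%E -> forall V, F V -> exists2 x, V x & (M < f x)%E.
Proof.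
move=> lt_M V FV.
have : (M < ereal_sup (f @` V))%E.
  by apply: lt_le_trans lt_M _; apply: ereal_inf_lbound; exists V.
by move=> /ereal_sup_gt[_ [x Vx <-] Mx]; exists x.
Qed.

Lemma bigmaxe_ge (R : realType) (f : nat -> R) m i : (0 < i <= m)%N ->
  ((f i)%:E <= \big[maxe/-oo]_(1 <= j < m.+1) (f j)%:E)%E.
Proof.
by move=> im; apply: (@le_bigmax_seq _ _ _ _ _ i xpredT (fun j => (f j)%:E));
  rewrite // mem_index_iota.
Qed.

Lemma bigmaxe_gt (R : realType) (f : nat -> R) m (b : R) :
  (b%:E < \big[maxe/-oo]_(1 <= j < m.+1) (f j)%:E)%E ->
    exists2 i, (0 < i <= m)%N & b < f i.
Proof.
move=> h; apply: contrapT => nex; move: h; apply/negP; rewrite -leNgt big_nat.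
apply: bigmax_le => [|i im]; first exact: leNye.
by rewrite lee_fin leNgt; apply/negP => bi; apply: nex; exists i.
Qed.

Theorem corollary3p2 (R : realType) (X : tsurf R 7) (hX : B7 X)
    (alpha : R) (h01 : 0 < alpha < 1)
    (hirr : irrational alpha)
    (a : nat -> nat) (ha : forall n, (0 < n)%N -> (0 < a n)%N)
    (halpha : alpha = cf_inf R (fun k => a k.+1)) :
  Ldir X alpha =
  (7%:R%:E * limn_esup (fun n : nat =>
     \big[maxe/-oo]_(1 <= i < (a n).+1)
        (D R a n i /
         hmult (surf_act (Rmx R *m gmx R (rcons [seq a j | j <- iota 1 n.-1] i)) X)
           ^+ 2)%:E))%E.
Proof.
have [[f1 _] H2 _ _] := hX.
have hN : (7 < 3 * #|singular (hperm X) (vperm X)|)%N by have := card_singular H2; lia.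
have alE : alpha = cftail R a 1 by [].
set F := fun n : nat => _.
pose DM n i := D R a n.+1 i / dmult X (semiconv 1 0 a n i) (semiconv 0 1 a n i) ^+ 2.
have FE n : F n.+1 = (\big[maxe/-oo]_(1 <= i < (a n.+1).+1) (DM n i)%:E)%E.
  by apply: eq_bigr => i _; rewrite /DM -(hmult_semiconv a n i f1 hN).
set Lam := limn_esup F.
pose G t := 2 / Sys (surf_act (flow_mx 7 alpha t) X) ^+ 2.
have -> : Ldir X alpha = limf_esup (fun t => (G t)%:E) (pinfty_nbhs R).
  by rewrite /Ldir /L; congr limf_esup; apply/funext => t; rewrite flow_mx_surf.
(* Every real B above Lam then satisfies [1 <= B], as [Sys_upper] demands on account of the vectors
   that are not intermediate convergents. *)
have Lam1 : (1%:E <= Lam)%E.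
  apply: limf_esup_ge => V [m _ mV].
  have [n [i [mn ia D1]]] := exists_D_ge1 m f1 hN ha.
  exists n.+1; first by apply: mV; exact: leqW.
  by rewrite FE; apply: le_trans (bigmaxe_ge (DM n) ia); rewrite lee_fin.
apply/eqP; rewrite eq_le; apply/andP; split.
  have upper B' : (Lam < B'%:E)%E -> (limf_esup (fun t => (G t)%:E) (pinfty_nbhs R) <=
    (7%:R * B')%:E)%E.
    move=> LB'; have [B LB BB'] : exists2 B, (Lam < B%:E)%E & B < B'.
      case: Lam Lam1 LB' => [l _| |] //; rewrite lte_fin => lB'.
      by exists ((l + B') / 2); rewrite ?lte_fin; lra.
    have B1 : 1 <= B by have := le_lt_trans Lam1 LB; rewrite lte_fin; exact: ltW.
    have [V [m _ mV] FB] := limf_esup_lt LB.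
    have [|n i mn ia|T GT] := @Sys_upper R 7 X a B B' m f1 isT hN ha _ B1 BB'.
    - by rewrite -alE.
    - have := FB n.+1 (mV n.+1 (leqW mn)); rewrite FE -lee_fin; apply: le_trans.
      exact: (bigmaxe_ge (DM n) ia).
    apply: (@limf_esup_le _ _ _ _ _ [set t | T < t]).
      by exists T; split; [exact: num_real|].
    by move=> t Tt; rewrite lee_fin /G alE; exact: GT.
  case: Lam Lam1 upper => [l l1 upper|_ _|//]; last by rewrite mulry gtr0_sg// mul1e leey.
  apply/lee_addgt0Pr => e e0.
  have -> : (7%:R%:E * l%:E + e%:E = (7%:R * (l + e / 7%:R))%:E :> \bar R)%E.
    by rewrite -EFinM -EFinD mulrDr [7 * (_ / _)]mulrC divfK.
  by apply: upper; rewrite lte_fin ltrDl divr_gt0.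
have lower b : 0 < b -> (b%:E < Lam)%E -> ((7%:R * b)%:E <= limf_esup (fun t => (G
  t)%:E) (pinfty_nbhs R))%E.
  move=> b0 bL; have [b2 b2L bb2] : exists2 b2, (b2%:E < Lam)%E & b < b2.
    case: Lam Lam1 bL => [l _| |] //; last by exists (b + 1); rewrite ?ltry ?ltrDl.
    rewrite lte_fin => bl.
    by exists ((l + b) / 2); rewrite ?lte_fin; lra.
  apply: limf_esup_ge => V [T [_ TV]].
  (* One threshold for the two lower bounds on the height demanded by [Sys_lower]. *)
  pose c := b / (b2 - b) + expR T ^+ 2 + 1.
  have bb0 : 0 <= b / (b2 - b) by rewrite divr_ge0 ?subr_ge0 ?ltW.
  have T20 : 0 <= expR T ^+ 2 by exact: sqr_ge0.
  pose k := Num.Def.archi_bound c.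
  have ck : c < k%:R by apply: archi_boundP; rewrite /c; lra.
  have [|[//|n] /= kn] := limf_esup_gt b2L (V := [set n | k < n]%N); first by exists k.+1.
  rewrite FE => /bigmaxe_gt[i ia Db2].
  have cq : c < (convq a n.+1)%:R.
    by apply: (lt_le_trans ck); rewrite ler_nat (leq_trans _ (convq_ge n ha)).
  have [||t Tt Gt] := @Sys_lower R 7 X a b b2 T n i f1 isT hN ha b0 bb2 ia Db2.
  - by move: cq; rewrite /c; lra.
  - by move: cq; rewrite /c; lra.
  by exists t; [exact: TV|rewrite lee_fin /G alE].
case: Lam Lam1 lower => [l|_|//]; last first.
  move=> lower; rewrite mulry gtr0_sg// mul1e.
  rewrite leye_eq; apply/eqP; apply: eq_infty => r.
  apply: le_trans (lower (Num.max 1 r) _ (ltry _)); last by rewrite lt_max ltr01.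
  rewrite lee_fin; apply: (@le_trans _ _ (Num.max 1 r));
    first by rewrite le_max lexx orbT.
  by rewrite ler_peMl// ?ler1n// le_max ler01.
rewrite lee_fin => l1 lower; apply/lee_addgt0Pr => e e0.
(* The cap 1/2 keeps l - d positive, because l >= 1. *)
pose d := Num.min (e / 7%:R) (2%:R^-1).
have d0 : 0 < d by rewrite lt_min invr_gt0 ltr0n andbT divr_gt0.
have d2 : d <= 2%:R^-1 by rewrite ge_min lexx orbT.
have de : 7%:R * d <= e by rewrite mulrC -ler_pdivlMr// ge_min lexx.
have -> : (7%:R%:E * l%:E = (7%:R * (l - d))%:E + (7%:R * d)%:E :> \bar R)%E.
  by rewrite -EFinM -EFinD -mulrDr subrK.
by apply: leeD; [apply: lower; rewrite ?lte_fin; lra|rewrite lee_fin].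
Qed.
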